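(* Let $\mathfrak{C}$ be an $A$-coring with ${}_A\mathfrak{C}$ flat and let $\Lambda\in{}_B\mathcal{M}^{\mathfrak{C}}$ be quasi-finite as a right $\mathfrak{C}$-comodule. Let $\mathrm{h}_{\mathfrak{C}}(\Lambda,-)$ and $\mathrm{e}_{\mathfrak{C}}(\Lambda)$ be the cohom functor and the coendomorphism coring of $\Lambda$ respectively. Suppose that $\mathrm{e}_{\mathfrak{C}}(\Lambda)$ is flat as a left $B$-module. (1) If $\mathfrak{C}_A$ is flat, $\mathrm{e}_{\mathfrak{C}}(\Lambda)$ is flat as a right $B$-module, and $\Lambda$ is an injector-cogenerator as a right $\mathfrak{C}$-comodule, then the functors $$-\square_{\mathrm{e}_{\mathfrak{C}}(\Lambda)}\Lambda:\mathcal{M}^{\mathrm{e}_{\mathfrak{C}}(\Lambda)}\to\mathcal{M}^{\mathfrak{C}},\qquad\mathrm{h}_{\mathfrak{C}}(\Lambda,-):\mathcal{M}^{\mathfrak{C}}\to\mathcal{M}^{\mathrm{e}_{\mathfrak{C}}(\Lambda)}$$ are inverse equivalences. (2) If $\mathfrak{C}$ and $\mathrm{e}_{\mathfrak{C}}(\Lambda)$ are coseparable corings, and $\Lambda$ is a cogenerator preserving as a right $\mathfrak{C}$-comodule, then these two functors are inverse equivalences.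
   Context: $k$ is a commutative ring; $A,B$ are associative unital $k$-algebras. An $A$-coring is an $A$-bimodule $\mathfrak{C}$ with $A$-bimodule maps $\Delta_{\mathfrak C}:\mathfrak{C}\to\mathfrak{C}\otimes_A\mathfrak{C}$ (coassociative) and $\epsilon_{\mathfrak C}:\mathfrak{C}\to A$ (counit). $\mathcal M^{\mathfrak C}$ is the category of right $\mathfrak C$-comodules $(M,\rho_M)$, $\rho_M:M\to M\otimes_A\mathfrak C$; left comodules have coaction $\lambda$. ${}_B\mathcal M^{\mathfrak C}$: $(B,A)$-bimodules with a $B$-linear right $\mathfrak C$-coaction. $M\square_{\mathfrak{C}}N=\ker(\rho_M\otimes_AN-M\otimes_A\lambda_N)\subset M\otimes_AN$. $\mathfrak C$ is coseparable if $\Delta_{\mathfrak C}$ is a split monomorphism of $\mathfrak C$-bicomodules. $\Lambda$ is quasi-finite as a right $\mathfrak C$-comodule if $-\otimes_B\Lambda:\mathcal M_B\to\mathcal M^{\mathfrak C}$ has a left adjoint $\mathrm h_{\mathfrak C}(\Lambda,-):\mathcal M^{\mathfrak C}\to\mathcal M_B$; let $\theta_M:M\to\mathrm h_{\mathfrak C}(\Lambda,M)\otimes_B\Lambda$ be the unit. $\mathrm e_{\mathfrak C}(\Lambda)=\mathrm h_{\mathfrak C}(\Lambda,\Lambda)$ (left $B$-action by functoriality) is a $B$-coring with $\Delta_e,\epsilon_e$ the unique right $B$-linear maps with $(\Delta_e\otimes_B\Lambda)\theta_\Lambda=(\mathrm e_{\mathfrak C}(\Lambda)\otimes_B\theta_\Lambda)\theta_\Lambda$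 and $(\epsilon_e\otimes_B\Lambda)\theta_\Lambda=1_\Lambda$. $\Lambda$ is an $(\mathrm e_{\mathfrak C}(\Lambda),\mathfrak C)$-bicomodule with left coaction $\theta_\Lambda$, and $\mathrm h_{\mathfrak C}(\Lambda,M)$ is a right $\mathrm e_{\mathfrak C}(\Lambda)$-comodule via the unique right $B$-linear $\rho$ with $(\rho\otimes_B\Lambda)\theta_M=(\mathrm h_{\mathfrak C}(\Lambda,M)\otimes_B\theta_\Lambda)\theta_M$. $\Lambda$ is an injector-cogenerator (resp. a cogenerator preserving) as a right $\mathfrak C$-comodule if $-\otimes_B\Lambda:\mathcal M_B\to\mathcal M^{\mathfrak C}$ preserves injective cogenerator (resp. cogenerator) objects. *)

(* Defs.v *)
From HB Require Import structures.
From mathcomp Require Import all_boot all_algebra.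
From mathcomp Require Import generic_quotient boolp.

Set Implicit Arguments.
Unset Strict Implicit.
Unset Printing Implicit Defensive.

Import GRing.Theory.
Local Open Scope quotient_scope.
Local Open Scope ring_scope.

Section TensorProduct.
Variables (B : pzRingType) (M : lmodType B^c) (N : lmodType B).

(* Words stand for finite sums of pure tensors; no constructor for opposites is
   needed because (- x) (x) y is the opposite of x (x) y. *)
Inductive tensor_rel : seq (M * N) -> seq (M * N) -> Prop :=
| TRrefl s : tensor_rel s s
| TRsym s t : tensor_rel s t -> tensor_rel t s
| TRtrans s t u : tensor_rel s t -> tensor_rel t u -> tensor_rel s u
| TRcat s t s' t' :
    tensor_rel s s' -> tensor_rel t t' -> tensor_rel (s ++ t) (s' ++ t')
| TRcomm s t : tensor_rel (s ++ t) (t ++ s)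
| TRaddl x x' y : tensor_rel [:: (x + x', y)] [:: (x, y); (x', y)]
| TRaddr x y y' : tensor_rel [:: (x, y + y')] [:: (x, y); (x, y')]
| TRbal x (b : B) y : tensor_rel [:: ((b : B^c) *: x, y)] [:: (x, b *: y)]
| TRzero y : tensor_rel [:: (0, y)] [::].

Definition tensor_relb s t : bool := `[< tensor_rel s t >].

Lemma tensor_relb_refl : reflexive tensor_relb.
Proof. by move=> s; apply/asboolP; apply: TRrefl. Qed.
Lemma tensor_relb_sym : symmetric tensor_relb.
Proof. by move=> s t; apply/asboolP/asboolP; apply: TRsym. Qed.
Lemma tensor_relb_trans : transitive tensor_relb.
Proof.
by move=> t s u /asboolP h1 /asboolP h2; apply/asboolP; apply: TRtrans h1 h2.
Qed.

Canonical tensor_equiv := EquivRel tensor_relb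
  tensor_relb_refl tensor_relb_sym tensor_relb_trans.

Definition tensor := {eq_quot tensor_equiv}.
HB.instance Definition _ := Choice.on tensor.

Local Notation cls s := (\pi_(tensor) s).

Lemma tensor_clsP s t : cls s = cls t <-> tensor_rel s t.
Proof.
split=> [/eqmodP/asboolP //|h].
by apply/eqmodP/asboolP.
Qed.

Lemma tensor_repr (q : tensor) s : q = cls s -> tensor_rel (repr q) s.
Proof. by move=> ->; apply/tensor_clsP; rewrite reprK. Qed.

Definition tadd (p q : tensor) : tensor := cls (repr p ++ repr q).
Definition topp_word (s : seq (M * N)) := [seq (- u.1, u.2) | u <- s].
Definition topp (p : tensor) : tensor := cls (topp_word (repr p)).
Definition tzero : tensor := cls [::].

Lemma tadd_cls s t : tadd (cls s) (cls t) = cls (s ++ t).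
Proof. by apply/tensor_clsP; apply: TRcat; apply: tensor_repr. Qed.

Lemma tensor_clsE (q : tensor) : q = cls (repr q).
Proof. by rewrite reprK. Qed.

Lemma taddA : associative tadd.
Proof.
move=> p q r; rewrite (tensor_clsE p) (tensor_clsE q) (tensor_clsE r).
by rewrite !tadd_cls catA.
Qed.
Lemma taddC : commutative tadd.
Proof. by move=> p q; apply/tensor_clsP; apply: TRcomm. Qed.
Lemma tadd0 : left_id tzero tadd.
Proof. by move=> p; rewrite (tensor_clsE p) /tzero tadd_cls. Qed.

Lemma toppK : left_inverse tzero topp tadd.
Proof.
move=> p; rewrite {2}(tensor_clsE p) /topp tadd_cls; apply/tensor_clsP.
elim: (repr p) => [|[x y] s IH] /=; first exact: TRrefl.
have h1 : tensor_rel ((- x, y) :: topp_word s ++ (x, y) :: s)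
                     ([:: (- x, y)] ++ ((x, y) :: s ++ topp_word s)).
  rewrite -cat1s; apply: TRcat; first exact: TRrefl.
  exact: (TRcomm (topp_word s) ((x, y) :: s)).
apply: TRtrans h1 _.
apply: (@TRtrans _ (([:: (- x, y)] ++ [:: (x, y)]) ++ (topp_word s ++ s))).
  by apply: TRcat (TRrefl [:: (- x, y); (x, y)]) _; apply: TRcomm.
apply: (@TRtrans _ ([::] ++ [::])); last exact: TRrefl.
apply: TRcat => //=.
apply: TRtrans (TRsym (TRaddl (- x) x y)) _; rewrite addNr.
exact: TRzero.
Qed.

HB.instance Definition _ := GRing.isZmodule.Build tensor taddA taddC tadd0 toppK.

Definition tens (x : M) (y : N) : tensor := cls [:: (x, y)].

Lemma tensDl x x' y : tens (x + x') y = tens x y + tens x' y.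
Proof.
by rewrite /tens [RHS]tadd_cls; apply/tensor_clsP; apply: TRaddl.
Qed.
Lemma tensDr x y y' : tens x (y + y') = tens x y + tens x y'.
Proof.
by rewrite /tens [RHS]tadd_cls; apply/tensor_clsP; apply: TRaddr.
Qed.
Lemma tens_bal x (b : B) y : tens ((b : B^c) *: x) y = tens x (b *: y).
Proof. by apply/tensor_clsP; apply: TRbal. Qed.

Lemma tens_ind (P : tensor -> Prop) :
  (forall x y, P (tens x y)) -> (forall p q, P p -> P q -> P (p + q)) ->
  forall p, P p.
Proof.
move=> Pp Pa p; rewrite (tensor_clsE p).
have P0 : P (cls [::]).
  have <- : tens 0 0 = cls [::] by apply/tensor_clsP; apply: TRzero.
  exact: Pp.
elim: (repr p) => [|[x y] s IH] //.
have -> : cls ((x, y) :: s) = tens x y + cls s by rewrite [RHS]tadd_cls.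
exact: Pa.
Qed.

Section Lift.
Variable Z : zmodType.

Definition balanced (f : M -> N -> Z) : Prop :=
  [/\ forall x x' y, f (x + x') y = f x y + f x' y,
      forall x y y', f x (y + y') = f x y + f x y'
    & forall x (b : B) y, f ((b : B^c) *: x) y = f x (b *: y)].

Definition tlift_fun (f : M -> N -> Z) (hf : balanced f) (p : tensor) : Z :=
  \sum_(u <- repr p) f u.1 u.2.

Variables (f : M -> N -> Z) (hf : balanced f).

Lemma tlift_rel s t : tensor_rel s t ->
  \sum_(u <- s) f u.1 u.2 = \sum_(u <- t) f u.1 u.2.
Proof.
case: (hf) => hl hr hb.
elim=> //.
- by move=> ? ? ? _ -> _ ->.
- by move=> ? ? ? ? _ h1 _ h2; rewrite !big_cat /= h1 h2.
- by move=> s' t'; rewrite !big_cat /= addrC.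
- by move=> x x' y; rewrite !big_cons !big_nil !addr0 hl.
- by move=> x y y'; rewrite !big_cons !big_nil !addr0 hr.
- by move=> x b y; rewrite !big_cons !big_nil !addr0 hb.
- move=> y; rewrite !big_cons !big_nil !addr0 /=.
  by apply: (@addrI _ (f 0 y)); rewrite -hl !addr0.
Qed.

Lemma tlift_cls s : tlift_fun hf (cls s) = \sum_(u <- s) f u.1 u.2.
Proof. by apply: tlift_rel; apply: tensor_repr. Qed.

Lemma tlift_additive : zmod_morphism (tlift_fun hf).
Proof.
have hD : {morph tlift_fun hf : p q / p + q}.
  move=> p q; rewrite -[p + q]/(tadd p q) /tadd tlift_cls big_cat.
  by [].
move=> p q; apply: (@addIr _ (tlift_fun hf q)).
by rewrite -hD !subrK.
Qed.

HB.instance Definition _ :=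
  GRing.isZmodMorphism.Build tensor Z (tlift_fun hf) tlift_additive.

Definition tlift : {additive tensor -> Z} := tlift_fun hf.

Lemma tliftE x y : tlift (tens x y) = f x y.
Proof. by rewrite /= tlift_cls big_seq1. Qed.

End Lift.
End TensorProduct.

(* Associative unital algebras over k; unlike algType, the zero algebra is
   allowed.  A right module over A is a left module over the converse ring
   A^c, so that (a : A^c) *: x denotes x . a. *)
Record kalgebra (k : comPzRingType) := KAlgebra {
  kalg_ring :> pzRingType;
  kalg_unit : {rmorphism k -> kalg_ring};
  kalg_central : forall (c : k) (a : kalg_ring),
    kalg_unit c * a = a * kalg_unit c
}.

(* B-A-bimodules: a right A-module with a left action of B by A-linear
   endomorphisms, on which the two actions of k agree. *)
Record bimodule (k : comPzRingType) (B A : kalgebra k) := Bimodule {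
  bim_car :> lmodType A^c;
  lact : B -> {linear bim_car -> bim_car};
  lact1 : forall x, lact 1 x = x;
  lactM : forall b c x, lact (b * c) x = lact b (lact c x);
  lactD : forall b c x, lact (b + c) x = lact b x + lact c x;
  lact_k : forall (c : k) x,
    lact (kalg_unit B c) x = (kalg_unit A c : A^c) *: x
}.

Arguments lact {k B A _} _.

Section LeftModule.
Variables (k : comPzRingType) (B A : kalgebra k) (N : bimodule B A).

Definition bim_left : Type := N.
HB.instance Definition _ := GRing.Zmodule.on bim_left.

Definition bim_lscale (b : B) (x : bim_left) : bim_left := lact b x.

Lemma bim_lscaleA b c x : bim_lscale b (bim_lscale c x) = bim_lscale (b * c) x.
Proof. by rewrite /bim_lscale lactM. Qed.
Lemma bim_lscale1 : left_id 1 bim_lscale.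
Proof. by move=> x; exact: lact1. Qed.
Lemma bim_lscaleDr : right_distributive bim_lscale +%R.
Proof. by move=> b x y; exact: (linearD (lact b)). Qed.
Lemma bim_lscaleDl x : {morph bim_lscale^~ x : b c / b + c}.
Proof. by move=> b c; exact: lactD. Qed.

HB.instance Definition _ := GRing.Zmodule_isLmodule.Build B bim_left
  bim_lscaleA bim_lscale1 bim_lscaleDr bim_lscaleDl.
End LeftModule.

Section BimoduleTensor.
Variables (k : comPzRingType) (B A : kalgebra k).
Variables (M : lmodType B^c) (N : bimodule B A).

(* M (x)_B N as a right A-module, A acting on N. *)
Definition tensr : Type := tensor M (bim_left N).
HB.instance Definition _ := GRing.Zmodule.on tensr.

Definition tpure (x : M) (y : N) : tensr := tens x (y : bim_left N).

Lemma tpureDl x x' y : tpure (x + x') y = tpure x y + tpure x' y.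
Proof. exact: (@tensDl _ M (bim_left N)). Qed.
Lemma tpureDr x y y' : tpure x (y + y') = tpure x y + tpure x y'.
Proof. exact: (@tensDr _ M (bim_left N)). Qed.
Lemma tpure_bal x (b : B) y : tpure ((b : B^c) *: x) y = tpure x (lact b y).
Proof. exact: (@tens_bal _ M (bim_left N)). Qed.

Lemma tensr_ind (P : tensr -> Prop) :
  (forall x y, P (tpure x y)) -> (forall p q, P p -> P q -> P (p + q)) ->
  forall p, P p.
Proof. exact: (@tens_ind _ M (bim_left N)). Qed.

Lemma tensr_ext (Z : zmodType) (f g : {additive tensr -> Z}) :
  (forall x y, f (tpure x y) = g (tpure x y)) -> f =1 g.
Proof.
by move=> h; apply: tensr_ind => // p q hp hq; rewrite !raddfD hp hq.
Qed.

Lemma tensr_scale_balanced (a : A) :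
  @balanced B M (bim_left N) tensr (fun x y => tpure x ((a : A^c) *: (y : N))).
Proof.
split=> [x x' y|x y y'|x b y]; first exact: tpureDl.
  rewrite -tpureDr; congr tpure; exact: scalerDr.
by rewrite tpure_bal; congr tpure; exact: (linearZZ (@lact _ _ _ N b) (a : A^c) y).
Qed.

Definition tensr_scale (a : A^c) (p : tensr) : tensr :=
  tlift (tensr_scale_balanced a) p.

Lemma tensr_scaleE a x y : tensr_scale a (tpure x y) = tpure x (a *: y).
Proof. exact: tliftE. Qed.

Lemma tensr_scaleDr : right_distributive tensr_scale +%R.
Proof. by move=> a x y; exact: (raddfD (tlift _)). Qed.
Lemma tensr_scaleA a b p :
  tensr_scale a (tensr_scale b p) = tensr_scale (a * b) p.
Proof.
elim/tensr_ind: p => [x y|p q hp hq]; first by rewrite !tensr_scaleE scalerA.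
by rewrite !tensr_scaleDr hp hq.
Qed.
Lemma tensr_scale1 : left_id 1 tensr_scale.
Proof.
elim/tensr_ind => [x y|p q hp hq]; first by rewrite tensr_scaleE scale1r.
by rewrite tensr_scaleDr hp hq.
Qed.
Lemma tensr_scaleDl p : {morph tensr_scale^~ p : a b / a + b}.
Proof.
move=> a b; elim/tensr_ind: p => [x y|p q hp hq] /=.
  by rewrite !tensr_scaleE scalerDl tpureDr.
by rewrite !tensr_scaleDr hp hq addrACA.
Qed.

HB.instance Definition _ := GRing.Zmodule_isLmodule.Build A^c tensr
  tensr_scaleA tensr_scale1 tensr_scaleDr tensr_scaleDl.

Lemma tpureZ (a : A^c) x y : a *: tpure x y = tpure x (a *: y).
Proof. exact: tensr_scaleE. Qed.

Section Lift.
Variables (Z : lmodType A^c) (f : M -> N -> Z).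

Definition lbalanced : Prop :=
  [/\ forall x x' y, f (x + x') y = f x y + f x' y,
      forall x y y', f x (y + y') = f x y + f x y',
      forall x (b : B) y, f ((b : B^c) *: x) y = f x (lact b y)
    & forall x y (a : A^c), f x (a *: y) = a *: f x y].

Hypothesis hf : lbalanced.

Lemma lbalanced_balanced : @balanced B M (bim_left N) Z f.
Proof. by case: hf. Qed.

Definition tensr_lift_fun (p : tensr) : Z := tlift lbalanced_balanced p.

Lemma tensr_lift_linear : linear tensr_lift_fun.
Proof.
have hD p q : tensr_lift_fun (p + q) = tensr_lift_fun p + tensr_lift_fun q.
  exact: (raddfD (tlift _)).
move=> a p q; rewrite hD; congr (_ + _).
elim/tensr_ind: p => [x y|p p' hp hp'].
  rewrite tpureZ /tensr_lift_fun !tliftE.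
  by case: hf.
by rewrite scalerDr !hD scalerDr hp hp'.
Qed.
End Lift.

HB.instance Definition _ (Z : lmodType A^c) f hf := GRing.isLinear.Build A^c tensr Z *:%R
  (@tensr_lift_fun Z f hf) (tensr_lift_linear hf).

Definition tensr_lift (Z : lmodType A^c) f hf : {linear tensr -> Z} := @tensr_lift_fun Z f hf.

Lemma tensr_liftE Z f hf x y : @tensr_lift Z f hf (tpure x y) = f x y.
Proof. exact: (@tliftE _ M (bim_left N)). Qed.

End BimoduleTensor.

Definition mk_linear (R : pzRingType) (U V : lmodType R) (f : U -> V)
    (hf : linear f) : {linear U -> V} :=
  HB.pack f (GRing.isLinear.Build R U V *:%R f hf).

Lemma linear_ext (R : pzRingType) (U V : lmodType R) (f g : {linear U -> V}) :
  f =1 g -> f = g.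
Proof.
move=> h; have e : (f : U -> V) = g by apply: funext.
case: f g e {h} => f [[f1] [f2]] [g [[g1] [g2]]] /= e.
subst g.
by rewrite (Prop_irrelevance f1 g1) (Prop_irrelevance f2 g2).
Qed.

Section BimoduleHom.
Variables (k : comPzRingType) (B A : kalgebra k).

Record bimod_hom (N N' : bimodule B A) := BimodHom {
  bim_fun :> {linear N -> N'};
  bim_funl : forall b x, bim_fun (lact b x) = lact b (bim_fun x)
}.

Lemma bimod_hom_ext N N' (f g : bimod_hom N N') : f =1 g -> f = g.
Proof.
case: f g => f hf [g hg] /= /linear_ext e; subst g.
by rewrite (Prop_irrelevance hf hg).
Qed.

Definition idb (N : bimodule B A) : bimod_hom N N :=
  @BimodHom N N (idfun : {linear N -> N}) (fun b x => erefl).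
End BimoduleHom.

Section TensorMap.
Variables (k : comPzRingType) (B A : kalgebra k).
Variables (M M' : lmodType B^c) (N N' : bimodule B A).
Variables (f : {linear M -> M'}) (g : bimod_hom N N').

Lemma tmap_balanced :
  @lbalanced k B A M N (tensr M' N') (fun x y => tpure (f x) (g y)).
Proof.
split=> [x x' y|x y y'|x b y|x y a].
- by rewrite linearD tpureDl.
- by rewrite linearD tpureDr.
- by rewrite linearZZ tpure_bal bim_funl.
- by rewrite linearZZ tpureZ.
Qed.

Definition tmap : {linear tensr M N -> tensr M' N'} := tensr_lift tmap_balanced.

Lemma tmapE x y : tmap (tpure x y) = tpure (f x) (g y).
Proof. exact: tensr_liftE. Qed.
End TensorMap.

Section BimoduleTensor2.
Variables (k : comPzRingType) (D B A : kalgebra k).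
Variables (M : bimodule D B) (N : bimodule B A).

Definition tensb_lact (d : D) : {linear tensr M N -> tensr M N} :=
  tmap (lact d) (idb N).

Lemma tensb_lact1 p : tensb_lact 1 p = p.
Proof.
elim/tensr_ind: p => [x y|p q hp hq]; first by rewrite tmapE lact1.
by rewrite linearD hp hq.
Qed.
Lemma tensb_lactM b c p : tensb_lact (b * c) p = tensb_lact b (tensb_lact c p).
Proof.
elim/tensr_ind: p => [x y|p q hp hq]; first by rewrite !tmapE lactM.
by rewrite !linearD hp hq.
Qed.
Lemma tensb_lactD b c p : tensb_lact (b + c) p = tensb_lact b p + tensb_lact c p.
Proof.
elim/tensr_ind: p => [x y|p q hp hq]; first by rewrite !tmapE lactD tpureDl.
by rewrite !linearD hp hq addrACA.
Qed.
Lemma tensb_lact_k (c : k) p :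
  tensb_lact (kalg_unit D c) p = (kalg_unit A c : A^c) *: p.
Proof.
elim/tensr_ind: p => [x y|p q hp hq].
  by rewrite tmapE lact_k tpure_bal lact_k tpureZ.
by rewrite linearD scalerDr hp hq.
Qed.

Definition tensb : bimodule D A :=
  @Bimodule k D A (tensr M N) tensb_lact
    tensb_lact1 tensb_lactM tensb_lactD tensb_lact_k.

Lemma tensb_lactE d x y :
  lact d (tpure x y : tensb) = tpure (lact d x) y :> tensr M N.
Proof. exact: tmapE. Qed.
End BimoduleTensor2.

Section TensorMapBimodule.
Variables (k : comPzRingType) (D B A : kalgebra k).
Variables (M M' : bimodule D B) (N N' : bimodule B A).
Variables (f : bimod_hom M M') (g : bimod_hom N N').

Lemma tmapb_lact d (p : tensb M N) :
  tmap f g (lact d p) = lact d (tmap f g p : tensb M' N').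
Proof.
elim/tensr_ind: p => [x y|p q hp hq].
  by rewrite (tensb_lactE d x y) !tmapE bim_funl.
by rewrite !linearD hp hq.
Qed.

Definition tmapb : bimod_hom (tensb M N) (tensb M' N') :=
  @BimodHom k D A (tensb M N) (tensb M' N') (tmap f g) tmapb_lact.
End TensorMapBimodule.

Section RegularBimodule.
Variables (k : comPzRingType) (A : kalgebra k).

Lemma regb_lact_linear (b : A) : linear (fun x : (A^c)^o => (b * x : A) : (A^c)^o).
Proof. by move=> a x y; rewrite [LHS]mulrDr [X in X + _]mulrA. Qed.

Definition regb_lact (b : A) : {linear (A^c)^o -> (A^c)^o} :=
  mk_linear (regb_lact_linear b).

Lemma regb_lact1 x : regb_lact 1 x = x.
Proof. exact: (@mul1r A). Qed.
Lemma regb_lactM b c x : regb_lact (b * c) x = regb_lact b (regb_lact c x).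
Proof. exact: (fun x y => esym (@mulrA A x y _)). Qed.
Lemma regb_lactD b c x : regb_lact (b + c) x = regb_lact b x + regb_lact c x.
Proof. exact: (@mulrDl A). Qed.
Lemma regb_lact_k (c : k) x :
  regb_lact (kalg_unit A c) x = (kalg_unit A c : A^c) *: x.
Proof. exact: (@kalg_central k A). Qed.

Definition regb : bimodule A A :=
  @Bimodule k A A (A^c)^o regb_lact regb_lact1 regb_lactM regb_lactD regb_lact_k.
End RegularBimodule.

Section Associativity.
Variables (k : comPzRingType) (B A A' : kalgebra k).
Variables (M : lmodType B^c) (N : bimodule B A) (P : bimodule A A').

Let T := tensr M (tensb N P).

Lemma tassoc_in_balanced (z : P) :
  @balanced B M (bim_left N) T
    (fun x y => tpure x (tpure (y : N) z : tensb N P)).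
Proof.
split=> [x x' y|x y y'|x b y]; first exact: tpureDl.
  by rewrite -tpureDr -tpureDl.
by rewrite tpure_bal; congr tpure; exact: tensb_lactE.
Qed.

Definition tassoc_in (p : tensr M N) (z : P) : T := tlift (tassoc_in_balanced z) p.

Lemma tassoc_inE x y z : tassoc_in (tpure x y) z = tpure x (tpure y z : tensb N P).
Proof. exact: tliftE. Qed.
Lemma tassoc_inD p q z : tassoc_in (p + q) z = tassoc_in p z + tassoc_in q z.
Proof. exact: (raddfD (tlift _)). Qed.

Lemma tassoc_balanced : @lbalanced k A A' (tensr M N) P T tassoc_in.
Proof.
split=> [p q z|p z z'|p a z|p z a]; first exact: tassoc_inD.
- elim/tensr_ind: p => [x y|p q hp hq]; first by rewrite !tassoc_inE !tpureDr.
  by rewrite !tassoc_inD hp hq addrACA.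
- elim/tensr_ind: p => [x y|p q hp hq].
    by rewrite tpureZ !tassoc_inE tpure_bal.
  by rewrite scalerDr !tassoc_inD hp hq.
- elim/tensr_ind: p => [x y|p q hp hq]; first by rewrite !tassoc_inE !tpureZ.
  by rewrite !tassoc_inD hp hq scalerDr.
Qed.

Definition tassoc : {linear tensr (tensr M N) P -> tensr M (tensb N P)} :=
  tensr_lift tassoc_balanced.

Lemma tassocE x y z : tassoc (tpure (tpure x y) z) = tpure x (tpure y z : tensb N P).
Proof. by rewrite tensr_liftE tassoc_inE. Qed.

Lemma tpurel_linear (x : M) : linear (fun y : N => tpure x y).
Proof. by move=> a y y'; rewrite tpureDr tpureZ. Qed.

Definition tpurel (x : M) : {linear N -> tensr M N} := mk_linear (tpurel_linear x).

Lemma tassoc'_balanced :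
  @lbalanced k B A' M (tensb N P) (tensr (tensr M N) P)
    (fun x q => tmap (tpurel x) (idb P) q).
Proof.
split=> [x x' q|x q q'|x b q|x q a].
- elim/tensr_ind: q => [y z|p q hp hq]; first by rewrite !tmapE -!tpureDl.
  by rewrite !linearD hp hq addrACA.
- by rewrite linearD.
- elim/tensr_ind: q => [y z|p q hp hq].
    by rewrite (tensb_lactE b y z) !tmapE /= tpure_bal.
  by rewrite !linearD hp hq.
- by rewrite linearZZ.
Qed.

Definition tassoc' : {linear tensr M (tensb N P) -> tensr (tensr M N) P} :=
  tensr_lift tassoc'_balanced.

Lemma tassoc'E x y z :
  tassoc' (tpure x (tpure y z : tensb N P)) = tpure (tpure x y) z.
Proof. by rewrite tensr_liftE tmapE. Qed.

Lemma tassoc'l x q : tassoc' (tpure x q) = tmap (tpurel x) (idb P) q.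
Proof. exact: tensr_liftE. Qed.

Lemma tassocK : cancel tassoc tassoc'.
Proof.
elim/tensr_ind => [p z|p q hp hq]; last by rewrite !linearD hp hq.
elim/tensr_ind: p => [x y|p q hp hq]; first by rewrite tassocE tassoc'E.
by rewrite tpureDl !linearD hp hq.
Qed.

Lemma tassoc'K : cancel tassoc' tassoc.
Proof.
elim/tensr_ind => [x p|p q hp hq]; last by rewrite !linearD hp hq.
elim/tensr_ind: p => [y z|p q hp hq]; first by rewrite tassoc'E tassocE.
by rewrite tpureDr !linearD hp hq.
Qed.

End Associativity.

Arguments tassoc {k B A A' M N P}.
Arguments tassoc' {k B A A' M N P}.
Arguments tassoc : simpl never.
Arguments tassoc' : simpl never.
Arguments tensr_lift : simpl never.
Arguments tmap : simpl never.

Section Unit.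
Variables (k : comPzRingType) (B A : kalgebra k).

Lemma tunitr_balanced (M : lmodType B^c) :
  @lbalanced k B B M (regb B) M (fun x (b : B) => (b : B^c) *: x).
Proof.
split=> [x x' b|x b b'|x b b'|x b b'].
- by rewrite scalerDr.
- by rewrite scalerDl.
- by rewrite scalerA.
- by rewrite scalerA.
Qed.

Definition tunitr (M : lmodType B^c) : {linear tensr M (regb B) -> M} :=
  tensr_lift (tunitr_balanced M).

Lemma tunitrE (M : lmodType B^c) (x : M) (b : B) :
  tunitr M (tpure x (b : regb B)) = (b : B^c) *: x.
Proof. exact: tensr_liftE. Qed.

Lemma tunitl_balanced (N : bimodule B A) :
  @lbalanced k B A (regb B) N N (fun b x => lact (b : B) x).
Proof.
split=> [b b' x|b x x'|b b' x|b x a].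
- exact: lactD.
- exact: linearD.
- exact: lactM.
- exact: linearZZ.
Qed.

Definition tunitl (N : bimodule B A) : {linear tensr (regb B) N -> N} :=
  tensr_lift (tunitl_balanced N).

Lemma tunitlE (N : bimodule B A) (b : B) (x : N) :
  tunitl N (tpure (b : regb B) x) = lact b x.
Proof. exact: tensr_liftE. Qed.
End Unit.

Arguments tunitr : simpl never.
Arguments tunitl : simpl never.

Section TensorMapLeft.
Variables (B : pzRingType) (M : lmodType B^c) (X Y : lmodType B).
Variable g : {linear X -> Y}.

Lemma tmap_left_balanced : @balanced B M X (tensor M Y) (fun x y => tens x (g y)).
Proof.
split=> [x x' y|x y y'|x b y]; first exact: tensDl.
  by rewrite linearD tensDr.
by rewrite linearZZ tens_bal.
Qed.

Definition tmap_left : {additive tensor M X -> tensor M Y} :=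
  tlift tmap_left_balanced.
End TensorMapLeft.

Definition exact_at (X Y Z : zmodType) (f : X -> Y) (g : Y -> Z) : Prop :=
  forall y, g y = 0 <-> exists x, f x = y.

Definition flat_left (k : comPzRingType) (B A : kalgebra k) (N : bimodule B A) :
    Prop :=
  forall (X Y Z : lmodType B^c) (f : {linear X -> Y}) (g : {linear Y -> Z}),
    exact_at f g -> exact_at (tmap f (idb N)) (tmap g (idb N)).

Definition flat_right (k : comPzRingType) (B A : kalgebra k) (N : bimodule B A) :
    Prop :=
  forall (X Y Z : lmodType A) (f : {linear X -> Y}) (g : {linear Y -> Z}),
    exact_at f g -> exact_at (tmap_left N f) (tmap_left N g).

Definition idl (R : pzRingType) (M : lmodType R) : {linear M -> M} := idfun.
Definition compl (R : pzRingType) (U V W : lmodType R)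
  (g : {linear V -> W}) (f : {linear U -> V}) : {linear U -> W} := g \o f.

Section TensorTheory.
Variable k : comPzRingType.

Lemma tmap_id (B A : kalgebra k) (M : lmodType B^c) (N : bimodule B A) (p : tensr M N) :
  tmap (idl M) (idb N) p = p.
Proof.
elim/tensr_ind: p => [x y|p q hp hq]; first by rewrite tmapE.
by rewrite linearD hp hq.
Qed.

Definition compb (B A : kalgebra k) (N N' N'' : bimodule B A)
    (g : bimod_hom N' N'') (f : bimod_hom N N') : bimod_hom N N'' :=
  @BimodHom k B A N N'' (compl g f)
    (fun b x => etrans (congr1 g (bim_funl f b x)) (bim_funl g b (f x))).

Lemma tmap_comp (B A : kalgebra k) (M M' M'' : lmodType B^c)
    (N N' N'' : bimodule B A) (f : {linear M -> M'}) (f' : {linear M' -> M''})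
    (g : bimod_hom N N') (g' : bimod_hom N' N'') (p : tensr M N) :
  tmap f' g' (tmap f g p) = tmap (compl f' f) (compb g' g) p.
Proof.
elim/tensr_ind: p => [x y|p q hp hq]; first by rewrite !tmapE.
by rewrite !linearD hp hq.
Qed.

Lemma tmap_eq (B A : kalgebra k) (M M' : lmodType B^c)
    (N N' : bimodule B A) (f f' : {linear M -> M'})
    (g g' : bimod_hom N N') (p : tensr M N) :
  f =1 f' -> g =1 g' -> tmap f g p = tmap f' g' p.
Proof. by move=> /linear_ext -> /bimod_hom_ext ->. Qed.

Lemma tassoc_nat (B A A' : kalgebra k) (M M' : lmodType B^c)
    (N N' : bimodule B A) (P P' : bimodule A A')
    (f : {linear M -> M'}) (g : bimod_hom N N') (h : bimod_hom P P') p :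
  tassoc (tmap (tmap f g) h p) = tmap f (tmapb g h) (tassoc p).
Proof.
elim/tensr_ind: p => [p z|p q hp hq]; last by rewrite !linearD hp hq.
elim/tensr_ind: p => [x y|p q hp hq].
  by rewrite tassocE !tmapE tassocE.
by rewrite tpureDl !linearD hp hq.
Qed.

Lemma tassoc'_nat (B A A' : kalgebra k) (M M' : lmodType B^c)
    (N N' : bimodule B A) (P P' : bimodule A A')
    (f : {linear M -> M'}) (g : bimod_hom N N') (h : bimod_hom P P') p :
  tassoc' (tmap f (tmapb g h) p) = tmap (tmap f g) h (tassoc' p).
Proof. by apply: (can_inj (@tassocK _ _ _ _ _ _ _)); rewrite tassoc'K tassoc_nat tassoc'K. Qed.

Lemma tassoc_lact (E B A A' : kalgebra k) (M : bimodule E B) (N : bimodule B A)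
    (P : bimodule A A') e (p : tensb (tensb M N) P) :
  tassoc (lact e p : tensb (tensb M N) P) = lact e (tassoc p : tensb M (tensb N P)).
Proof.
elim/tensr_ind: p => [p z|p q hp hq]; last by rewrite !linearD hp hq.
elim/tensr_ind: p => [x y|p q hp hq].
  rewrite (tensb_lactE e (tpure x y : tensb M N) z) (tensb_lactE e x y).
  by rewrite !tassocE (tensb_lactE e x (tpure y z : tensb N P)).
by rewrite tpureDl !linearD hp hq.
Qed.

Definition tassocb (E B A A' : kalgebra k) (M : bimodule E B) (N : bimodule B A)
    (P : bimodule A A') : bimod_hom (tensb (tensb M N) P) (tensb M (tensb N P)) :=
  @BimodHom k E A' (tensb (tensb M N) P) (tensb M (tensb N P)) tassoc
    (@tassoc_lact E B A A' M N P).

Lemma tassoc'_lact (E B A A' : kalgebra k) (M : bimodule E B) (N : bimodule B A)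
    (P : bimodule A A') e (p : tensb M (tensb N P)) :
  tassoc' (lact e p : tensb M (tensb N P)) = lact e (tassoc' p : tensb (tensb M N) P).
Proof.
apply: (can_inj (@tassocK _ _ _ _ _ _ _)).
by rewrite tassoc'K (tassoc_lact e (tassoc' p)) tassoc'K.
Qed.

Definition tassocb' (E B A A' : kalgebra k) (M : bimodule E B) (N : bimodule B A)
    (P : bimodule A A') : bimod_hom (tensb M (tensb N P)) (tensb (tensb M N) P) :=
  @BimodHom k E A' (tensb M (tensb N P)) (tensb (tensb M N) P) tassoc'
    (@tassoc'_lact E B A A' M N P).

Lemma tassoc_pentagon (E B A A' : kalgebra k) (M : lmodType E^c) (N : bimodule E B)
    (P : bimodule B A) (Q : bimodule A A') p :
  tmap (idl M) (tassocb N P Q) (tassoc (tmap tassoc (idb Q) p)) =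
  tassoc (tassoc p) :> tensr M (tensb N (tensb P Q)).
Proof.
elim/tensr_ind: p => [p z|p q hp hq]; last by rewrite !linearD hp hq.
elim/tensr_ind: p => [p y|p q hp hq]; last by rewrite tpureDl !linearD hp hq.
elim/tensr_ind: p => [x w|p q hp hq].
  by rewrite tmapE !tassocE tmapE /= tassocE.
by rewrite !tpureDl !linearD hp hq.
Qed.

Section MapIdentities.
Variables (B A : kalgebra k).
Implicit Types M : lmodType B^c.
Implicit Types N : bimodule B A.

Lemma tmap_ll M M' M'' N (f : {linear M' -> M''}) (g : {linear M -> M'})
    (p : tensr M N) :
  tmap f (idb N) (tmap g (idb N) p) = tmap (compl f g) (idb N) p.
Proof. by rewrite tmap_comp; exact: tmap_eq. Qed.

Lemma tmap_rr M N N' N'' (f : bimod_hom N' N'') (g : bimod_hom N N')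
    (p : tensr M N) :
  tmap (idl M) f (tmap (idl M) g p) = tmap (idl M) (compb f g) p.
Proof. by rewrite tmap_comp; exact: tmap_eq. Qed.

Lemma tmap_lr M M' N N' (f : {linear M -> M'}) (g : bimod_hom N N')
    (p : tensr M N) :
  tmap f (idb N') (tmap (idl M) g p) = tmap f g p.
Proof. by rewrite tmap_comp; exact: tmap_eq. Qed.

Lemma tmap_rl M M' N N' (f : {linear M -> M'}) (g : bimod_hom N N')
    (p : tensr M N) :
  tmap (idl M') g (tmap f (idb N) p) = tmap f g p.
Proof. by rewrite tmap_comp; exact: tmap_eq. Qed.
End MapIdentities.

Section AssocNat.
Variables (B A A' : kalgebra k).
Variables (M M' : lmodType B^c) (N N' : bimodule B A) (P P' : bimodule A A').

Lemma tmapb_id (p : tensb N P) : tmapb (idb N) (idb P) p = p.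
Proof. exact: (@tmap_id A A' N P p). Qed.

Lemma tassoc'_natl (f : {linear M -> M'}) (p : tensr M (tensb N P)) :
  tassoc' (tmap f (idb (tensb N P)) p) = tmap (tmap f (idb N)) (idb P) (tassoc' p).
Proof.
rewrite -tassoc'_nat; apply: (congr1 tassoc'); apply: tmap_eq => // q.
by rewrite tmapb_id.
Qed.

Lemma tassoc'_natm (g : bimod_hom N N') (p : tensr M (tensb N P)) :
  tassoc' (tmap (idl M) (tmapb g (idb P)) p) =
  tmap (tmap (idl M) g) (idb P) (tassoc' p).
Proof. exact: tassoc'_nat. Qed.

Lemma tassoc'_natr (h : bimod_hom P P') (p : tensr M (tensb N P)) :
  tassoc' (tmap (idl M) (tmapb (idb N) h) p) = tmap (idl (tensr M N)) h (tassoc' p).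
Proof.
rewrite tassoc'_nat; apply: tmap_eq => // q.
by rewrite tmap_id.
Qed.

Lemma tassoc_natl (f : {linear M -> M'}) (p : tensr (tensr M N) P) :
  tassoc (tmap (tmap f (idb N)) (idb P) p) = tmap f (idb (tensb N P)) (tassoc p).
Proof.
rewrite tassoc_nat; apply: tmap_eq => // q.
by rewrite tmapb_id.
Qed.

Lemma tassoc_natm (g : bimod_hom N N') (p : tensr (tensr M N) P) :
  tassoc (tmap (tmap (idl M) g) (idb P) p) =
  tmap (idl M) (tmapb g (idb P)) (tassoc p).
Proof. exact: tassoc_nat. Qed.

Lemma tassoc_natr (h : bimod_hom P P') (p : tensr (tensr M N) P) :
  tassoc (tmap (idl (tensr M N)) h p) = tmap (idl M) (tmapb (idb N) h) (tassoc p).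
Proof.
rewrite -tassoc_nat; apply: (congr1 tassoc); apply: tmap_eq => // q.
by rewrite tmap_id.
Qed.
End AssocNat.

Section Pentagon'.
Variables (E B A A' : kalgebra k) (M : lmodType E^c) (N : bimodule E B).
Variables (P : bimodule B A) (Q : bimodule A A').

Lemma tassoc'_pentagon (p : tensr M (tensb N (tensb P Q))) :
  tassoc' (tmap (idl M) (tassocb' N P Q) p) =
  tmap tassoc (idb Q) (tassoc' (tassoc' p)).
Proof.
rewrite -{1}(tassoc'K p) -{1}(tassoc'K (tassoc' p)) -tassoc_pentagon.
set q := tmap tassoc _ _; rewrite tmap_rr.
rewrite -[RHS](@tassocK _ _ _ _ _ _ _ q); apply: (congr1 tassoc').
rewrite -[RHS]tmap_id; apply: tmap_eq => // r; exact: tassocK.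
Qed.

Lemma tassoc'_pentagon2 (p : tensr M (tensb (tensb N P) Q)) :
  tmap tassoc' (idb Q) (tassoc' p) = tassoc' (tassoc' (tmap (idl M) (tassocb N P Q) p)).
Proof.
have := tassoc'_pentagon (tmap (idl M) (tassocb N P Q) p); rewrite tmap_rr.
have -> : tmap (idl M) (compb (tassocb' N P Q) (tassocb N P Q)) p = p.
  by rewrite -[RHS]tmap_id; apply: tmap_eq => // r; exact: tassocK.
move=> ->; rewrite tmap_ll -[RHS]tmap_id; apply: tmap_eq => // r.
exact: tassocK.
Qed.
End Pentagon'.

Section UnitTheory.
Variables (B A A' : kalgebra k).

Lemma tunitr_lact (N : bimodule B A) b (p : tensb N (regb A)) :
  tunitr N (lact b p) = lact b (tunitr N p).
Proof.
elim/tensr_ind: p => [x a|p q hp hq]; last by rewrite !linearD hp hq.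
by rewrite (tensb_lactE b x a) !tunitrE linearZZ.
Qed.

Definition tunitrb (N : bimodule B A) : bimod_hom (tensb N (regb A)) N :=
  @BimodHom k B A (tensb N (regb A)) N (tunitr N) (@tunitr_lact N).

Lemma tunitl_lact (N : bimodule B A) b (p : tensb (regb B) N) :
  tunitl N (lact b p) = lact b (tunitl N p).
Proof.
elim/tensr_ind: p => [x a|p q hp hq]; last by rewrite !linearD hp hq.
by rewrite (tensb_lactE b x a) !tunitlE -lactM.
Qed.

Definition tunitlb (N : bimodule B A) : bimod_hom (tensb (regb B) N) N :=
  @BimodHom k B A (tensb (regb B) N) N (tunitl N) (@tunitl_lact N).

Lemma tunit_triangle (M : lmodType B^c) (N : bimodule B A)
    (p : tensr M (tensb (regb B) N)) :
  tmap (tunitr M) (idb N) (tassoc' p) = tmap (idl M) (tunitlb N) p.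
Proof.
elim/tensr_ind: p => [x p|p q hp hq]; last by rewrite !linearD hp hq.
elim/tensr_ind: p => [b y|p q hp hq]; last by rewrite tpureDr !linearD hp hq.
by rewrite tassoc'E !tmapE tunitrE /= tunitlE tpure_bal.
Qed.

Lemma tunitr_assoc (M : lmodType B^c) (N : bimodule B A)
    (p : tensr M (tensb N (regb A))) :
  tunitr (tensr M N) (tassoc' p) = tmap (idl M) (tunitrb N) p.
Proof.
elim/tensr_ind: p => [x p|p q hp hq]; last by rewrite !linearD hp hq.
elim/tensr_ind: p => [y a|p q hp hq]; last by rewrite tpureDr !linearD hp hq.
by rewrite tassoc'E tmapE !tunitrE tpureZ.
Qed.

Lemma tunitl_assoc (N : bimodule B A) (P : bimodule A A')
    (p : tensr (regb B) (tensb N P)) :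
  tmap (tunitl N) (idb P) (tassoc' p) = tunitl (tensb N P) p.
Proof.
elim/tensr_ind: p => [b p|p q hp hq]; last by rewrite !linearD hp hq.
elim/tensr_ind: p => [x y|p q hp hq]; last by rewrite tpureDr !linearD hp hq.
by rewrite tassoc'E tmapE !tunitlE (tensb_lactE (b : B) x y).
Qed.

Lemma tunitr_nat (M M' : lmodType B^c) (f : {linear M -> M'}) p :
  tunitr M' (tmap f (idb (regb B)) p) = f (tunitr M p).
Proof.
elim/tensr_ind: p => [x b|p q hp hq]; last by rewrite !linearD hp hq.
by rewrite tmapE !tunitrE linearZZ.
Qed.

Lemma tunitl_inj (N : bimodule B A) : injective (tunitl N).
Proof.
apply: (@can_inj _ _ _ (fun x => tpure (1 : regb B) x)).
elim/tensr_ind => [b x|p q hp hq]; last by rewrite linearD tpureDr hp hq.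
rewrite tunitlE -(@tpure_bal _ _ _ (regb B) N); congr tpure.
exact: (@mul1r B).
Qed.
End UnitTheory.

Lemma tmap_add (B A : kalgebra k) (M M' : lmodType B^c) (N : bimodule B A)
    (f g h : {linear M -> M'}) (p : tensr M N) :
  (forall x, h x = f x + g x) ->
  tmap h (idb N) p = tmap f (idb N) p + tmap g (idb N) p.
Proof.
move=> e; elim/tensr_ind: p => [x y|p q hp hq].
  by rewrite !tmapE e tpureDl.
by rewrite !linearD hp hq addrACA.
Qed.

Lemma tmap_zero (B A : kalgebra k) (M M' : lmodType B^c) (N : bimodule B A)
    (f : {linear M -> M'}) (p : tensr M N) :
  (forall x, f x = 0) -> tmap f (idb N) p = 0.
Proof.
move=> e; apply: (@addrI _ (tmap f (idb N) p)); rewrite addr0.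
by rewrite -(@tmap_add _ _ _ _ _ f f f p) // => x; rewrite e addr0.
Qed.
End TensorTheory.

Record category := Category {
  obj :> Type;
  hom : obj -> obj -> Type;
  idc : forall x, hom x x;
  comp : forall x y z, hom y z -> hom x y -> hom x z;
  comp1c : forall x y (f : hom x y), comp (idc y) f = f;
  compc1 : forall x y (f : hom x y), comp f (idc x) = f;
  compcA : forall w x y z (f : hom y z) (g : hom x y) (h : hom w x),
    comp f (comp g h) = comp (comp f g) h
}.

Record functor (C D : category) := Functor {
  fobj :> C -> D;
  fmap : forall x y, hom x y -> hom (fobj x) (fobj y);
  fmap1 : forall x, fmap (idc x) = idc (fobj x);
  fmapM : forall x y z (f : hom y z) (g : hom x y),
    fmap (comp f g) = comp (fmap f) (fmap g)
}.

Definition functor_id (C : category) : functor C C :=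
  @Functor C C (fun x => x) (fun x y f => f) (fun x => erefl)
    (fun x y z f g => erefl).

Definition functor_comp (C D E : category) (G : functor D E) (F : functor C D) :
    functor C E :=
  @Functor C E (fun x => G (F x)) (fun x y f => fmap G (fmap F f))
    (fun x => etrans (congr1 (fmap G (y:=F x)) (fmap1 F x)) (fmap1 G (F x)))
    (fun x y z f g => etrans (congr1 (fmap G (y:=F z)) (fmapM F f g))
                             (fmapM G (fmap F f) (fmap F g))).

Record nattrans (C D : category) (F G : functor C D) := Nattrans {
  nat_comp :> forall x, hom (F x) (G x);
  nat_natural : forall x y (f : hom x y),
    comp (nat_comp y) (fmap F f) = comp (fmap G f) (nat_comp x)
}.

Record adjunction (C D : category) (L : functor C D) (R : functor D C) :=
  Adjunction {
  adj_unit : nattrans (functor_id C) (functor_comp R L);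
  adj_counit : nattrans (functor_comp L R) (functor_id D);
  adj_triangle_l : forall x,
    comp (adj_counit (L x)) (fmap L (adj_unit x)) = idc (L x);
  adj_triangle_r : forall y,
    comp (fmap R (adj_counit y)) (adj_unit (R y)) = idc (R y)
}.

Section CategoryNotions.
Variable C : category.

Definition is_iso (x y : C) (f : hom x y) : Prop :=
  exists g : hom y x, comp g f = idc x /\ comp f g = idc y.

Definition is_mono (x y : C) (f : hom x y) : Prop :=
  forall w (g h : hom w x), comp f g = comp f h -> g = h.

Definition is_injective (q : C) : Prop :=
  forall (x y : C) (i : hom x y), is_mono i ->
  forall f : hom x q, exists g : hom y q, comp g i = f.

Definition is_cogenerator (q : C) : Prop :=
  forall (x y : C) (f g : hom x y),
    (forall u : hom y q, comp u f = comp u g) -> f = g.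
End CategoryNotions.

Definition naturally_isomorphic (C D : category) (F G : functor C D) : Prop :=
  exists t : nattrans F G, forall x, is_iso (t x).

Definition inverse_equivalences (C D : category) (F : functor C D)
    (G : functor D C) : Prop :=
  naturally_isomorphic (functor_comp G F) (functor_id C) /\
  naturally_isomorphic (functor_comp F G) (functor_id D).

Section AdjunctionTheory.
Variables (C D : category) (L : functor C D) (R : functor D C).
Variable adj : adjunction L R.

Definition adj_transpose (x : C) (y : D) (g : hom x (R y)) : hom (L x) y :=
  comp (adj_counit adj y) (fmap L g).

Lemma adj_transposeE (x : C) (y : D) (g : hom x (R y)) :
  comp (fmap R (adj_transpose g)) (adj_unit adj x) = g.
Proof.
rewrite /adj_transpose fmapM -compcA.
have /= <- := nat_natural (adj_unit adj) g.
by rewrite compcA adj_triangle_r comp1c.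
Qed.

Lemma adj_transpose_uniq (x : C) (y : D) (f g : hom (L x) y) :
  comp (fmap R f) (adj_unit adj x) = comp (fmap R g) (adj_unit adj x) -> f = g.
Proof.
move=> h.
have key u : u = comp (adj_counit adj y) (fmap L (comp (fmap R u) (adj_unit adj x))).
  rewrite fmapM compcA.
  have /= -> := nat_natural (adj_counit adj) u.
  by rewrite -compcA adj_triangle_l compc1.
by rewrite (key f) h -key.
Qed.
End AdjunctionTheory.

Definition mod_cat (k : comPzRingType) (B : kalgebra k) : category :=
  @Category (lmodType B^c) (fun M N => {linear M -> N}) (fun M => idl M)
    (fun M N P g f => compl g f)
    (fun M N f => @linear_ext _ M N (compl (idl N) f) f (fun x => erefl))
    (fun M N f => @linear_ext _ M N (compl f (idl M)) f (fun x => erefl))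
    (fun M N P Q f g h => @linear_ext _ M Q
       (compl f (compl g h)) (compl (compl f g) h) (fun x => erefl)).

Section Corings.
Variable k : comPzRingType.

Record coring (A : kalgebra k) := Coring {
  cor_bim :> bimodule A A;
  cor_delta : bimod_hom cor_bim (tensb cor_bim cor_bim);
  cor_eps : bimod_hom cor_bim (regb A);
  cor_coassoc : forall x,
    tassoc (tmap cor_delta (idb cor_bim) (cor_delta x)) =
    tmap (idl cor_bim) cor_delta (cor_delta x);
  cor_counitl : forall x,
    tunitl cor_bim (tmap cor_eps (idb cor_bim) (cor_delta x)) = x;
  cor_counitr : forall x,
    tunitr cor_bim (tmap (idl cor_bim) cor_eps (cor_delta x)) = x
}.

(* Delta splits as a map of C-bicomodules, where C (x) C has the left and
   right coactions Delta (x) C and C (x) Delta. *)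
Definition coseparable (A : kalgebra k) (C : coring A) : Prop :=
  exists p : bimod_hom (tensb C C) C,
    [/\ forall x, p (cor_delta C x) = x,
        forall z : tensb C C,
          cor_delta C (p z) =
          tmap (idl C) p (tassoc (tmap (cor_delta C) (idb C) z))
      & forall z : tensb C C,
          cor_delta C (p z) =
          tmap p (idb C) (tassoc' (tmap (idl C) (cor_delta C) z))].

Section Comodules.
Variables (A : kalgebra k) (C : coring A).

Record comodule := Comodule {
  com_mod :> lmodType A^c;
  com_rho : {linear com_mod -> tensr com_mod C};
  com_coassoc : forall x,
    tassoc (tmap com_rho (idb C) (com_rho x)) =
    tmap (idl com_mod) (cor_delta C) (com_rho x);
  com_counit : forall x,
    tunitr com_mod (tmap (idl com_mod) (cor_eps C) (com_rho x)) = x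
}.

Record comod_hom (M N : comodule) := ComodHom {
  com_fun :> {linear M -> N};
  com_funP : forall x, com_rho N (com_fun x) = tmap com_fun (idb C) (com_rho M x)
}.

Lemma comod_hom_ext (M N : comodule) (f g : comod_hom M N) : f =1 g -> f = g.
Proof.
case: f g => f hf [g hg] /= /linear_ext e; subst g.
by rewrite (Prop_irrelevance hf hg).
Qed.

Lemma comod_id_subproof (M : comodule) x :
  com_rho M (idl M x) = tmap (idl M) (idb C) (com_rho M x).
Proof. by rewrite tmap_id. Qed.

Definition comod_id (M : comodule) : comod_hom M M :=
  ComodHom (@comod_id_subproof M).

Lemma comod_comp_subproof (M N P : comodule) (g : comod_hom N P)
    (f : comod_hom M N) x :
  com_rho P (compl g f x) = tmap (compl g f) (idb C) (com_rho M x).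
Proof. by rewrite /= !com_funP tmap_ll. Qed.

Definition comod_comp (M N P : comodule) (g : comod_hom N P) (f : comod_hom M N) :
  comod_hom M P := ComodHom (comod_comp_subproof g f).

Definition comod_cat : category :=
  @Category comodule comod_hom comod_id comod_comp
    (fun M N f => @comod_hom_ext M N (comod_comp (comod_id N) f) f (fun x => erefl))
    (fun M N f => @comod_hom_ext M N (comod_comp f (comod_id M)) f (fun x => erefl))
    (fun M N P Q f g h => @comod_hom_ext M Q
       (comod_comp f (comod_comp g h)) (comod_comp (comod_comp f g) h)
       (fun x => erefl)).
End Comodules.

(* B-A-bimodules with a left B-linear right C-coaction. *)
Record bcomodule (B A : kalgebra k) (C : coring A) := Bcomodule {
  bco_bim :> bimodule B A;
  bco_rho : bimod_hom bco_bim (tensb bco_bim C);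
  bco_coassoc : forall x,
    tassoc (tmap bco_rho (idb C) (bco_rho x)) =
    tmap (idl bco_bim) (cor_delta C) (bco_rho x);
  bco_counit : forall x,
    tunitr bco_bim (tmap (idl bco_bim) (cor_eps C) (bco_rho x)) = x
}.

Record bicomodule (B A : kalgebra k) (D : coring B) (C : coring A) := Bicomodule {
  bic_bco :> bcomodule B C;
  bic_lambda : bimod_hom bic_bco (tensb D bic_bco);
  bic_coassoc : forall x,
    tassoc (tmap (cor_delta D) (idb bic_bco) (bic_lambda x)) =
    tmap (idl D) bic_lambda (bic_lambda x);
  bic_counit : forall x,
    tunitl bic_bco (tmap (cor_eps D) (idb bic_bco) (bic_lambda x)) = x;
  bic_compat : forall x,
    tassoc (tmap bic_lambda (idb C) (bco_rho bic_bco x)) =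
    tmap (idl D) (bco_rho bic_bco) (bic_lambda x)
}.

Section TensorFunctor.
Variables (B A : kalgebra k) (C : coring A) (L : bcomodule B C).

Definition bco_comod : comodule C :=
  @Comodule A C L (bco_rho L) (@bco_coassoc _ _ _ L) (@bco_counit _ _ _ L).

Section Object.
Variable W : lmodType B^c.

Definition tenf_rho : {linear tensr W L -> tensr (tensr W L) C} :=
  compl tassoc' (tmap (idl W) (bco_rho L)).

Lemma tenf_rhoE p : tenf_rho p = tassoc' (tmap (idl W) (bco_rho L) p).
Proof. by []. Qed.

Lemma tenf_coassoc (p : tensr W L) :
  tassoc (tmap tenf_rho (idb C) (tenf_rho p)) =
  tmap (idl (tensr W L)) (cor_delta C) (tenf_rho p).
Proof.
rewrite /tenf_rho -tmap_ll -tassoc'_natm tassoc'_pentagon2 tassoc'K.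
rewrite -tassoc'_natr !tmap_rr; apply: (congr1 tassoc'); apply: tmap_eq => // x.
exact: bco_coassoc.
Qed.

Lemma tenf_counit (p : tensr W L) :
  tunitr (tensr W L) (tmap (idl (tensr W L)) (cor_eps C) (tenf_rho p)) = p.
Proof.
rewrite /tenf_rho -tassoc'_natr tunitr_assoc !tmap_rr.
by rewrite -[RHS]tmap_id; apply: tmap_eq => // x; exact: bco_counit.
Qed.

Definition tenf_obj : comodule C := Comodule tenf_coassoc tenf_counit.
End Object.

Lemma tenf_map_subproof (W W' : lmodType B^c) (f : {linear W -> W'}) p :
  com_rho (tenf_obj W') (tmap f (idb L) p) =
  tmap (tmap f (idb L)) (idb C) (com_rho (tenf_obj W) p).
Proof. by rewrite /= /tenf_rho /= -tassoc'_natl tmap_lr tmap_rl. Qed.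

Definition tenf_map (W W' : lmodType B^c) (f : {linear W -> W'}) :
    comod_hom (tenf_obj W) (tenf_obj W') :=
  @ComodHom A C (tenf_obj W) (tenf_obj W') (tmap f (idb L)) (tenf_map_subproof f).

Lemma tenf_map1 (W : lmodType B^c) : tenf_map (idl W) = comod_id (tenf_obj W).
Proof. by apply: comod_hom_ext => p; exact: tmap_id. Qed.

Lemma tenf_mapM (W W' W'' : lmodType B^c) (f : {linear W' -> W''})
    (g : {linear W -> W'}) :
  tenf_map (compl f g) = comod_comp (tenf_map f) (tenf_map g).
Proof. by apply: comod_hom_ext => p; rewrite /= tmap_ll. Qed.

Definition tensor_functor : functor (mod_cat B) (comod_cat C) :=
  @Functor (mod_cat B) (comod_cat C) tenf_obj tenf_map tenf_map1 tenf_mapM.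
End TensorFunctor.

Definition injector_cogenerator (B A : kalgebra k) (C : coring A)
    (L : bcomodule B C) : Prop :=
  forall Q : mod_cat B, is_injective Q /\ is_cogenerator Q ->
    is_injective (tensor_functor L Q) /\ is_cogenerator (tensor_functor L Q).

Definition cogenerator_preserving (B A : kalgebra k) (C : coring A)
    (L : bcomodule B C) : Prop :=
  forall Q : mod_cat B, is_cogenerator Q -> is_cogenerator (tensor_functor L Q).
End Corings.

Section Kernel.
Variables (R : pzRingType) (U V : lmodType R) (f : {linear U -> V}).

Definition kerp : {pred U} := [pred x | f x == 0].

Lemma kerp_submod : submod_closed kerp.
Proof.
split=> [|a x y]; first by rewrite inE linear0.
by rewrite !inE linearP => /eqP -> /eqP ->; rewrite scaler0 addr0.
Qed.

HB.instance Definition _ := GRing.isSubmodClosed.Build R U kerp kerp_submod.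

Record kerm := Kerm { ker_val :> U; _ : ker_val \in kerp }.

HB.instance Definition _ := [isSub for ker_val].
HB.instance Definition _ := [Choice of kerm by <:].
HB.instance Definition _ := [SubChoice_isSubLmodule of kerm by <:].

Lemma ker_inc_linear : linear (ker_val : kerm -> U).
Proof. by []. Qed.

Definition ker_inc : {linear kerm -> U} := mk_linear ker_inc_linear.

Lemma ker_inc_inj : injective ker_inc.
Proof. exact: val_inj. Qed.

Lemma ker_incP (x : kerm) : f (ker_inc x) = 0.
Proof. by case: x => x hx; apply/eqP. Qed.

Lemma ker_exact : exact_at ker_inc f.
Proof.
move=> y; split=> [/eqP hy|[x <-]]; last exact: ker_incP.
by exists (Kerm hy).
Qed.
End Kernel.

Section Subcomodule.
Variables (k : comPzRingType).

Lemma flat_inj (B A : kalgebra k) (N : bimodule B A) (X Y : lmodType B^c)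
    (f : {linear X -> Y}) :
  flat_left N -> injective f -> injective (tmap f (idb N)).
Proof.
move=> fl fi; have zl : linear (fun x : X => 0 : X).
  by move=> a x y; rewrite scaler0 addr0.
have ex : exact_at (mk_linear zl) f.
  move=> y; split=> [h|[x <-]]; last by rewrite linear0.
  by exists 0; apply: fi; rewrite /= linear0 h.
move=> p q e; apply/eqP; rewrite -subr_eq0; apply/eqP.
have /(fl _ _ _ _ _ ex) [r <-] : tmap f (idb N) (p - q) = 0.
  by rewrite linearB /= e subrr.
exact: tmap_zero.
Qed.

Variables (A : kalgebra k) (C : coring A) (flatC : flat_left C).
Variables (X : comodule C) (K : lmodType A^c) (i : {linear K -> X}).
Hypothesis i_inj : injective i.
Hypothesis i_sub : forall x, exists z, tmap i (idb C) z = com_rho X (i x).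

Definition sub_rho_fun (x : K) : tensr K C := projT1 (cid (i_sub x)).

Lemma sub_rho_funE x : tmap i (idb C) (sub_rho_fun x) = com_rho X (i x).
Proof. exact: (projT2 (cid (i_sub x))). Qed.

Lemma sub_rho_linear : linear sub_rho_fun.
Proof.
move=> a x y; apply: (flat_inj flatC i_inj).
by rewrite sub_rho_funE !linearP /= !sub_rho_funE.
Qed.

Definition sub_rho : {linear K -> tensr K C} := mk_linear sub_rho_linear.

Lemma sub_rhoE x : tmap i (idb C) (sub_rho x) = com_rho X (i x).
Proof. exact: sub_rho_funE. Qed.

Lemma sub_coassoc x :
  tassoc (tmap sub_rho (idb C) (sub_rho x)) = tmap (idl K) (cor_delta C) (sub_rho x).
Proof.
apply: (can_inj (@tassoc'K _ _ _ _ _ _ _)); rewrite tassocK.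
apply: (flat_inj flatC (flat_inj flatC i_inj)).
rewrite -tassoc'_natl tmap_ll tmap_lr -(tmap_rl i (cor_delta C)).
rewrite sub_rhoE -com_coassoc tassocK.
by rewrite -sub_rhoE tmap_ll; apply: tmap_eq => // y; rewrite /= sub_rhoE.
Qed.

Lemma sub_counit x : tunitr K (tmap (idl K) (cor_eps C) (sub_rho x)) = x.
Proof.
apply: i_inj; rewrite -tunitr_nat tmap_lr -(tmap_rl i (cor_eps C)) sub_rhoE.
exact: com_counit.
Qed.

Definition sub_comodule : comodule C := Comodule sub_coassoc sub_counit.

Definition sub_inc : comod_hom sub_comodule X :=
  @ComodHom k A C sub_comodule X i (fun x => esym (sub_rhoE x)).
End Subcomodule.

Section CotensorFunctor.
Variables (k : comPzRingType) (B A : kalgebra k) (D : coring B) (C : coring A).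
Variables (flatC : flat_left C) (N : bicomodule D C).

Section Object.
Variable M : comodule D.

Let T := tensr M (tensb D N).

Definition cot_left : {linear tensr M N -> T} :=
  compl tassoc (tmap (com_rho M) (idb N)).
Definition cot_right : {linear tensr M N -> T} :=
  tmap (idl M) (bic_lambda N).

Lemma cot_diff_linear : linear (fun p => cot_left p - cot_right p).
Proof.
move=> a p q; rewrite (linearP cot_left) (linearP cot_right).
by rewrite opprD addrACA scalerBr.
Qed.

Definition cot_diff : {linear tensr M N -> T} := mk_linear cot_diff_linear.

Definition cotensor : lmodType A^c := kerm cot_diff.

Definition cot_inc : {linear cotensor -> tensr M N} := ker_inc cot_diff.

Lemma cot_incP p : cot_left (cot_inc p) = cot_right (cot_inc p).
Proof. by apply/eqP; rewrite -subr_eq0; apply/eqP; exact: (ker_incP p). Qed.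

Lemma cot_incE (q : tensr M N) :
  cot_left q = cot_right q -> exists p, cot_inc p = q.
Proof. by move=> h; apply/(ker_exact cot_diff); apply/eqP; rewrite subr_eq0; apply/eqP. Qed.

Lemma cot_sub p : exists z, tmap cot_inc (idb C) z = com_rho (tenf_obj N M) (cot_inc p).
Proof.
apply/(flatC (ker_exact cot_diff)).
set x := cot_inc p; rewrite /= /tenf_rho /=.
have e q : tmap cot_diff (idb C) q = tmap cot_left (idb C) q - tmap cot_right (idb C) q.
  apply/eqP; rewrite eq_sym subr_eq; apply/eqP.
  by apply: tmap_add => y; rewrite /= subrK.
rewrite e -[cot_left]/(compl tassoc (tmap (com_rho M) (idb N))).
apply/eqP; rewrite subr_eq0; apply/eqP.
rewrite -tmap_ll -tassoc'_natl tmap_lr -(tmap_rl (com_rho M)).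
rewrite -[in LHS](tassocK (tmap (com_rho M) (idb N) x)).
rewrite -tassoc'_natr -tassoc'_pentagon [tassoc _](cot_incP p).
rewrite -/x /cot_right -tassoc'_natm !tmap_rr; apply: (congr1 tassoc').
apply: tmap_eq => // y /=.
by apply: (can_inj (@tassocK _ _ _ _ _ _ _)); rewrite tassoc'K /= bic_compat.
Qed.

Definition cotensor_comod : comodule C :=
  @sub_comodule k A C flatC (tenf_obj N M) cotensor cot_inc
    (@ker_inc_inj _ _ _ cot_diff) cot_sub.

Lemma cot_rhoE p :
  tmap cot_inc (idb C) (com_rho cotensor_comod p) = com_rho (tenf_obj N M) (cot_inc p).
Proof.
exact: (@sub_rhoE k A C flatC (tenf_obj N M) cotensor cot_inc
  (@ker_inc_inj _ _ _ cot_diff) cot_sub).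
Qed.
End Object.

Section Map.
Variables (M M' : comodule D) (f : comod_hom M M').

Lemma cot_map_sub (p : cotensor M) :
  exists q : cotensor M', cot_inc M' q = tmap f (idb N) (cot_inc M p).
Proof.
apply: cot_incE; rewrite /cot_left /cot_right /= tmap_ll.
have -> q : tmap (compl (com_rho M') f) (idb N) q =
   tmap (tmap f (idb D)) (idb N) (tmap (com_rho M) (idb N) q).
  by rewrite tmap_ll; apply: tmap_eq => // x; exact: com_funP.
by rewrite tassoc_natl [tassoc _](cot_incP p) tmap_lr tmap_rl.
Qed.

Definition cot_map_fun (p : cotensor M) : cotensor M' :=
  projT1 (cid (cot_map_sub p)).

Lemma cot_map_funE p : cot_inc M' (cot_map_fun p) = tmap f (idb N) (cot_inc M p).
Proof. exact: (projT2 (cid (cot_map_sub p))). Qed.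

Lemma cot_inc_inj : injective (cot_inc M').
Proof. exact: ker_inc_inj. Qed.

Lemma cot_map_linear : linear cot_map_fun.
Proof.
move=> a x y; apply: cot_inc_inj.
rewrite cot_map_funE (linearP (cot_inc M)) (linearP (tmap f (idb N))).
by rewrite (linearP (cot_inc M')) !cot_map_funE.
Qed.

Definition cot_map_lin : {linear cotensor M -> cotensor M'} :=
  mk_linear cot_map_linear.

Lemma cot_map_comod p :
  com_rho (cotensor_comod M') (cot_map_lin p) =
  tmap cot_map_lin (idb C) (com_rho (cotensor_comod M) p).
Proof.
apply: (flat_inj flatC cot_inc_inj); rewrite tmap_ll.
rewrite cot_rhoE cot_map_funE (com_funP (tenf_map N f)).
rewrite -cot_rhoE tmap_ll.
by apply: tmap_eq => // q; rewrite /= -cot_map_funE.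
Qed.

Definition cot_map : comod_hom (cotensor_comod M) (cotensor_comod M') :=
  @ComodHom k A C (cotensor_comod M) (cotensor_comod M') cot_map_lin cot_map_comod.
End Map.

Lemma cot_map1 M : cot_map (comod_id M) = comod_id (cotensor_comod M).
Proof.
apply: comod_hom_ext => p; apply: cot_inc_inj.
by rewrite cot_map_funE /= tmap_id.
Qed.

Lemma cot_mapM (M M' M'' : comodule D) (f : comod_hom M' M'') (g : comod_hom M M') :
  cot_map (comod_comp f g) = comod_comp (cot_map f) (cot_map g).
Proof.
apply: comod_hom_ext => p; apply: cot_inc_inj.
rewrite -[comod_comp (cot_map f) _ p]/(cot_map_fun f (cot_map_fun g p)).
by rewrite [LHS]cot_map_funE !cot_map_funE tmap_ll.
Qed.

(* - []_D N.  Since C is flat as a left A-module, - (x)_A C preserves the kernel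
   cotensor M, so the coaction of M (x)_B N restricts to it. *)
Definition cotensor_functor : functor (comod_cat D) (comod_cat C) :=
  @Functor (comod_cat D) (comod_cat C) cotensor_comod cot_map cot_map1 cot_mapM.
End CotensorFunctor.

Section Coendomorphism.
Variables (k : comPzRingType) (B A : kalgebra k) (C : coring A).
Variables (L : bcomodule B C) (h : functor (comod_cat C) (mod_cat B)).
Variable adj : adjunction h (tensor_functor L).

Let hM (M : comodule C) : lmodType B^c := h M.
Let LC : comodule C := bco_comod L.

(* theta_M *)
Definition cohom_unit (M : comodule C) : comod_hom M (tenf_obj L (h M)) :=
  adj_unit adj M.

Lemma cohom_uniq (M : comodule C) (W : lmodType B^c) (f g : {linear h M -> W}) :
  (forall x, tmap f (idb L) (cohom_unit M x) = tmap g (idb L) (cohom_unit M x)) ->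
  f = g.
Proof.
move=> e; apply: (@adj_transpose_uniq _ _ _ _ adj M W f g).
exact: comod_hom_ext.
Qed.

Definition cohom_tr (M : comodule C) (W : lmodType B^c)
    (g : comod_hom M (tenf_obj L W)) : {linear h M -> W} :=
  @adj_transpose _ _ _ _ adj M W g.

Lemma cohom_trE (M : comodule C) (W : lmodType B^c)
    (g : comod_hom M (tenf_obj L W)) x :
  tmap (cohom_tr g) (idb L) (cohom_unit M x) = g x.
Proof. exact: (congr1 (fun u : comod_hom M (tenf_obj L W) => u x)
  (@adj_transposeE _ _ _ _ adj M W g)). Qed.

Lemma cohom_unit_nat (M M' : comodule C) (f : comod_hom M M') x :
  tmap (fmap h f : {linear h M -> h M'}) (idb L) (cohom_unit M x) =
  cohom_unit M' (f x).
Proof.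
exact: esym (congr1 (fun u : comod_hom M (tenf_obj L (h M')) => u x)
  (@nat_natural _ _ _ _ (adj_unit adj) M M' f)).
Qed.

Section LeftAction.

Definition bco_lact (b : B) : comod_hom LC LC :=
  @ComodHom k A C LC LC (lact b) (bim_funl (bco_rho L) b).

Definition coend_lact (b : B) : {linear hM LC -> hM LC} := fmap h (bco_lact b).

Lemma coend_lact_unit b x :
  tmap (coend_lact b) (idb L) (cohom_unit LC x) = cohom_unit LC (lact b x).
Proof. exact: (cohom_unit_nat (bco_lact b)). Qed.

Lemma coend_lact1 x : coend_lact 1 x = x.
Proof.
suff -> : coend_lact 1 = idl (hM LC) by [].
by apply: cohom_uniq => y; rewrite coend_lact_unit lact1 tmap_id.
Qed.

Lemma coend_lactM b c x : coend_lact (b * c) x = coend_lact b (coend_lact c x).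
Proof.
suff -> : coend_lact (b * c) = compl (coend_lact b) (coend_lact c) by [].
by apply: cohom_uniq => y; rewrite -tmap_ll !coend_lact_unit lactM.
Qed.

Lemma coend_lactD b c x : coend_lact (b + c) x = coend_lact b x + coend_lact c x.
Proof.
have lin : linear (fun x => coend_lact b x + coend_lact c x).
  by move=> a u v; rewrite !linearP scalerDr addrACA.
suff -> : coend_lact (b + c) = mk_linear lin by [].
apply: cohom_uniq => y; rewrite coend_lact_unit lactD linearD.
by rewrite (@tmap_add _ _ _ _ _ _ (coend_lact b) (coend_lact c)) // !coend_lact_unit.
Qed.

Lemma coend_lact_k (c : k) x :
  coend_lact (kalg_unit B c) x = (kalg_unit B c : B^c) *: x.
Proof.
have lin : linear (fun x : hM LC => (kalg_unit B c : B^c) *: x).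
  move=> a u v; rewrite scalerDr !scalerA; congr (_ *: _ + _).
  exact: esym (@kalg_central k B c a).
suff -> : coend_lact (kalg_unit B c) = mk_linear lin by [].
apply: cohom_uniq => y; rewrite coend_lact_unit lact_k linearZZ.
elim/tensr_ind: (cohom_unit LC y) => [e l|p q hp hq].
  by rewrite tmapE tpureZ /= tpure_bal lact_k.
by rewrite scalerDr linearD hp hq.
Qed.

(* e(L) = h(L, L), the left B-action being given by functoriality of h. *)
Definition coend_bim : bimodule B B :=
  @Bimodule k B B (hM LC) coend_lact coend_lact1 coend_lactM coend_lactD coend_lact_k.

Definition cohom_unitb : bimod_hom L (tensb coend_bim L) :=
  @BimodHom k B A L (tensb coend_bim L) (cohom_unit LC)
    (fun b x => esym (coend_lact_unit b x)).
End LeftAction.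

Lemma cohom_unitb_colin x :
  tassoc' (tmap (idl coend_bim) (bco_rho L) (cohom_unitb x)) =
  tmap cohom_unitb (idb C) (bco_rho L x).
Proof. exact: (@com_funP _ _ _ _ _ (cohom_unit LC)). Qed.

Lemma tensor_unit_colin (W : lmodType B^c) (y : tensr W L) :
  tenf_rho L (tensr W coend_bim) (tassoc' (tmap (idl W) cohom_unitb y)) =
  tmap tassoc' (idb C) (tmap (tmap (idl W) cohom_unitb) (idb C) (tenf_rho L W y)).
Proof.
rewrite !tenf_rhoE -tassoc'_natm tassoc'_pentagon2 -tassoc'_natr !tmap_rr.
apply: (congr1 tassoc'); apply: (congr1 tassoc'); apply: tmap_eq => // l /=.
apply: (can_inj (@tassoc'K _ _ _ _ _ _ _)); rewrite tassocK.
exact: cohom_unitb_colin.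
Qed.

Section CohomCoaction.
Variable M : comodule C.

Definition cohom_rho_lin : {linear M -> tensr (tensr (hM M) coend_bim) L} :=
  compl tassoc' (compl (tmap (idl (hM M)) cohom_unitb) (cohom_unit M)).

Lemma cohom_unit_colin x :
  com_rho (tenf_obj L (h M)) (cohom_unit M x) =
  tmap (cohom_unit M) (idb C) (com_rho M x).
Proof. exact: com_funP. Qed.

Lemma cohom_rho_colin x :
  com_rho (tenf_obj L (tensr (hM M) coend_bim)) (cohom_rho_lin x) =
  tmap cohom_rho_lin (idb C) (com_rho M x).
Proof.
rewrite /cohom_rho_lin -tmap_ll -tmap_ll -cohom_unit_colin.
exact: tensor_unit_colin.
Qed.

(* The transpose of (h M (x) theta_L) theta_M, i.e. the unique right B-linear rho
   with (rho (x) L) theta_M = (h M (x) theta_L) theta_M; for M = L it is Delta_e. *)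
Definition cohom_rho : {linear hM M -> tensr (hM M) coend_bim} :=
  cohom_tr (@ComodHom k A C M (tenf_obj L (tensr (hM M) coend_bim))
    cohom_rho_lin cohom_rho_colin).

Lemma cohom_rhoE x :
  tmap cohom_rho (idb L) (cohom_unit M x) =
  tassoc' (tmap (idl (hM M)) cohom_unitb (cohom_unit M x)).
Proof. exact: cohom_trE. Qed.
End CohomCoaction.

Lemma cohom_rho_nat (M M' : comodule C) (f : comod_hom M M') y :
  cohom_rho M' ((fmap h f : {linear hM M -> hM M'}) y) =
  tmap (fmap h f : {linear hM M -> hM M'}) (idb coend_bim) (cohom_rho M y).
Proof.
set g : {linear hM M -> hM M'} := fmap h f.
suff e : compl (cohom_rho M') g = compl (tmap g (idb coend_bim)) (cohom_rho M).
  exact: (congr1 (fun u : {linear hM M -> _} => u y) e).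
apply: cohom_uniq => x; rewrite -(tmap_ll (cohom_rho M') g).
rewrite -(tmap_ll (tmap g (idb coend_bim))) cohom_unit_nat !cohom_rhoE.
by rewrite -tassoc'_natl tmap_lr -(tmap_rl g cohom_unitb) cohom_unit_nat.
Qed.

Definition coend_delta : bimod_hom coend_bim (tensb coend_bim coend_bim) :=
  @BimodHom k B B coend_bim (tensb coend_bim coend_bim) (cohom_rho LC)
    (fun b => cohom_rho_nat (bco_lact b)).

Lemma unit_inv_linear : linear (fun x : LC => tpure (1 : regb B) (x : L)).
Proof. by move=> a x y; rewrite tpureDr tpureZ. Qed.

Lemma unit_inv_colin (x : LC) :
  com_rho (tenf_obj L (regb B)) (tpure (1 : regb B) (x : L)) =
  tmap (mk_linear unit_inv_linear) (idb C) (com_rho LC x).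
Proof.
by rewrite [LHS]tenf_rhoE tmapE tassoc'l; exact: tmap_eq.
Qed.

(* The transpose of L = B (x)_B L, i.e. the unique right B-linear epsilon_e with
   (epsilon_e (x) L) theta_L = 1_L. *)
Definition coend_eps_lin : {linear coend_bim -> regb B} :=
  cohom_tr (@ComodHom k A C LC (tenf_obj L (regb B))
    (mk_linear unit_inv_linear) unit_inv_colin).

Lemma coend_eps_linE x :
  tmap coend_eps_lin (idb L) (cohom_unit LC x) = tpure (1 : regb B) (x : L).
Proof. exact: cohom_trE. Qed.

Lemma coend_eps_lact b x : coend_eps_lin (lact b x) = lact b (coend_eps_lin x).
Proof.
suff e : compl coend_eps_lin (coend_lact b) = compl (lact b) coend_eps_lin.
  exact: (congr1 (fun u : {linear coend_bim -> regb B} => u x) e).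
apply: cohom_uniq => y.
rewrite -(tmap_ll coend_eps_lin) -(tmap_ll (lact b) coend_eps_lin).
rewrite coend_lact_unit !coend_eps_linE tmapE.
rewrite -[lact b y]/(bco_lact b y) -tpure_bal; congr tpure.
exact: (etrans (@mul1r B b) (esym (@mulr1 B b))).
Qed.

Definition coend_eps : bimod_hom coend_bim (regb B) :=
  BimodHom coend_eps_lact.

Lemma coend_epsE x :
  tunitl L (tmap coend_eps (idb L) (cohom_unit LC x)) = x.
Proof. by rewrite coend_eps_linE tunitlE lact1. Qed.

Lemma cohom_coassoc (M : comodule C) y :
  tassoc (tmap (cohom_rho M) (idb coend_bim) (cohom_rho M y)) =
  tmap (idl (hM M)) coend_delta (cohom_rho M y).
Proof.
suff e : compl tassoc (compl (tmap (cohom_rho M) (idb coend_bim)) (cohom_rho M)) =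
         compl (tmap (idl (hM M)) coend_delta) (cohom_rho M).
  exact: (congr1 (fun u : {linear hM M -> _} => u y) e).
apply: cohom_uniq => x; rewrite -(tmap_ll (tmap _ coend_delta)).
rewrite -(tmap_ll tassoc) -(tmap_ll (tmap (cohom_rho M) _)) cohom_rhoE.
rewrite -tassoc'_natl tmap_lr -(tmap_rl (cohom_rho M)) cohom_rhoE.
rewrite -[tmap _ cohom_unitb _]tassoc'_natr -tassoc'_pentagon.
rewrite -tassoc'_natm !tmap_rr; apply: (congr1 tassoc'); apply: tmap_eq => // l /=.
by rewrite cohom_rhoE.
Qed.

Lemma cohom_counit (M : comodule C) y :
  tunitr (hM M) (tmap (idl (hM M)) coend_eps (cohom_rho M y)) = y.
Proof.
suff e : compl (tunitr (hM M)) (compl (tmap (idl (hM M)) coend_eps) (cohom_rho M)) =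
         idl (hM M).
  exact: (congr1 (fun u : {linear hM M -> _} => u y) e).
apply: cohom_uniq => x; rewrite -(tmap_ll (tunitr _)).
rewrite -(tmap_ll (tmap _ coend_eps)) cohom_rhoE tmap_id.
rewrite -tassoc'_natm tunit_triangle !tmap_rr -[RHS]tmap_id.
by apply: tmap_eq => // l; exact: coend_epsE.
Qed.

Lemma coend_counitl y :
  tunitl coend_bim (tmap coend_eps (idb coend_bim) (coend_delta y)) = y.
Proof.
suff e : compl (tunitl coend_bim)
    (compl (tmap coend_eps (idb coend_bim)) coend_delta) = idl coend_bim.
  exact: (congr1 (fun u : {linear hM LC -> _} => u y) e).
apply: cohom_uniq => x; rewrite -(tmap_ll (tunitl _)).
rewrite -(tmap_ll (tmap coend_eps _)) cohom_rhoE tmap_id.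
rewrite -tassoc'_natl tunitl_assoc tmap_lr -(tmap_rl coend_eps).
rewrite coend_eps_linE tmapE tunitlE; exact: (@lact1 _ _ _ (tensb coend_bim L)).
Qed.

Definition coend : coring B :=
  @Coring k B coend_bim coend_delta coend_eps
    (@cohom_coassoc LC) coend_counitl (@cohom_counit LC).

Definition cohom_comod (M : comodule C) : comodule coend :=
  @Comodule k B coend (hM M) (cohom_rho M) (@cohom_coassoc M) (@cohom_counit M).

Definition cohom_map (M M' : comodule C) (f : comod_hom M M') :
    comod_hom (cohom_comod M) (cohom_comod M') :=
  @ComodHom k B coend (cohom_comod M) (cohom_comod M') (fmap h f) (cohom_rho_nat f).

Lemma cohom_map1 M : cohom_map (comod_id M) = comod_id (cohom_comod M).
Proof.
apply: comod_hom_ext => x.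
exact: (congr1 (fun u : {linear hM M -> hM M} => u x) (fmap1 h M)).
Qed.

Lemma cohom_mapM (M M' M'' : comodule C) (f : comod_hom M' M'') (g : comod_hom M M') :
  cohom_map (comod_comp f g) = comod_comp (cohom_map f) (cohom_map g).
Proof.
apply: comod_hom_ext => x.
exact: (congr1 (fun u : {linear hM M -> hM M''} => u x) (fmapM h f g)).
Qed.

Definition cohom_functor : functor (comod_cat C) (comod_cat coend) :=
  @Functor (comod_cat C) (comod_cat coend) cohom_comod cohom_map cohom_map1 cohom_mapM.

Lemma coend_bic_compat x :
  tassoc (tmap cohom_unitb (idb C) (bco_rho L x)) =
  tmap (idl coend_bim) (bco_rho L) (cohom_unitb x).
Proof. by rewrite -cohom_unitb_colin tassoc'K. Qed.

Lemma coend_bic_coassoc x :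
  tassoc (tmap (cor_delta coend) (idb L) (cohom_unitb x)) =
  tmap (idl coend) cohom_unitb (cohom_unitb x).
Proof. by rewrite [tmap _ _ _]cohom_rhoE tassoc'K. Qed.

Definition coend_bicomodule : bicomodule coend C :=
  @Bicomodule k B A coend C L cohom_unitb coend_bic_coassoc coend_epsE coend_bic_compat.
End Coendomorphism.

(* Main.v *)
(* The cohomomorphism functor h is left adjoint to - (x)_B L, and h(W (x)_B L) = W (x)_B e(L),
   so that M |-> h(M) is the comparison functor into comodules over the comonad - (x)_B e(L).
   By Beck's argument it is an equivalence, with inverse the cotensor product, as soon as h is
   faithful and preserves, for every e(L)-comodule N, the equalizer
   N [] L -> N (x) L => N (x) e(L) (x) L: applying h to it yields
   N -> N (x) e(L) => N (x) e(L) (x) e(L), whose equalizer is N.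
   If Q is an injective cogenerator of M_B, then Hom_B(h(-), Q) = Hom(-, Q (x) L); hence h is
   faithful when Q (x) L is a cogenerator, and exact when it is moreover injective.  When e(L)
   is coseparable, the equalizer above is split, hence preserved by any functor. *)
Require Import Defs.
From HB Require Import structures.
From mathcomp Require Import all_boot all_algebra.
From mathcomp Require Import generic_quotient boolp classical_sets functions.

Set Implicit Arguments.
Unset Strict Implicit.
Unset Printing Implicit Defensive.

Import GRing.Theory Num.Theory.
Local Open Scope quotient_scope.
Local Open Scope ring_scope.

(** * Zero maps and cokernels of modules *)

Lemma zero_map_linear (R : pzRingType) (U V : lmodType R) : linear (fun _ : U => 0 : V).
Proof. by move=> a x y; rewrite scaler0 addr0. Qed.

Definition zero_map (R : pzRingType) (U V : lmodType R) : {linear U -> V} :=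
  mk_linear (@zero_map_linear R U V).

Section Cokernel.
Variables (R : pzRingType) (U V : lmodType R) (f : {linear U -> V}).

Definition img : {pred V} := [pred v | `[< exists u, f u = v >]].

Lemma img_submod : submod_closed img.
Proof.
split=> [|a x y]; first by apply/asboolP; exists 0; rewrite linear0.
move=> /asboolP [u <-] /asboolP [v <-]; apply/asboolP.
by exists (a *: u + v); rewrite linearP.
Qed.

HB.instance Definition _ := GRing.isSubmodClosed.Build R V img img_submod.

(** The quotient is taken as an additive group first; scalars then act through a chosen preimage,
    which is harmless because the image of [f] is a submodule. *)
Definition coker : Type := Quotient.quot img.
HB.instance Definition _ := GRing.Zmodule.on coker.

Definition coker_pi_fun (v : V) : coker := \pi_(Quotient.quot img) v.

Lemma coker_pi_eq v w : coker_pi_fun v = coker_pi_fun w <-> exists u, f u = v - w.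
Proof.
split=> [/eqP|[u e]].
  rewrite -[_ == _]/(v == w %[mod Quotient.quot img]).
  by rewrite -(@Quotient.idealrBE V img) => /asboolP.
apply/eqP; rewrite -[_ == _]/(v == w %[mod Quotient.quot img]).
by rewrite -(@Quotient.idealrBE V img); apply/asboolP; exists u.
Qed.

Lemma coker_pi_surj (p : coker) : exists v, coker_pi_fun v = p.
Proof. by exists (repr (p : Quotient.quot img)); exact: reprK. Qed.

Definition coker_scale (a : R) (p : coker) : coker :=
  coker_pi_fun (a *: projT1 (cid (coker_pi_surj p))).

Lemma coker_scaleE a v : coker_scale a (coker_pi_fun v) = coker_pi_fun (a *: v).
Proof.
rewrite /coker_scale; case: cid => w /= /coker_pi_eq [u e].
by apply/coker_pi_eq; exists (a *: u); rewrite linearZ -scalerBr e.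
Qed.

Lemma coker_piD v w : coker_pi_fun (v + w) = coker_pi_fun v + coker_pi_fun w.
Proof. exact: (raddfD (\pi_(Quotient.quot img))). Qed.

Lemma coker_scaleA a b p : coker_scale a (coker_scale b p) = coker_scale (a * b) p.
Proof. by case: (coker_pi_surj p) => v <-; rewrite !coker_scaleE scalerA. Qed.
Lemma coker_scale1 : left_id 1 coker_scale.
Proof. by move=> p; case: (coker_pi_surj p) => v <-; rewrite coker_scaleE scale1r. Qed.
Lemma coker_scaleDr : right_distributive coker_scale +%R.
Proof.
move=> a p q; case: (coker_pi_surj p) (coker_pi_surj q) => v <- [w <-].
by rewrite -coker_piD !coker_scaleE scalerDr coker_piD.
Qed.
Lemma coker_scaleDl p : {morph coker_scale^~ p : a b / a + b}.
Proof.
move=> a b; case: (coker_pi_surj p) => v <-.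
by rewrite !coker_scaleE scalerDl coker_piD.
Qed.

HB.instance Definition _ := GRing.Zmodule_isLmodule.Build R coker
  coker_scaleA coker_scale1 coker_scaleDr coker_scaleDl.

Lemma coker_pi_linear : linear coker_pi_fun.
Proof. by move=> a v w; rewrite coker_piD -coker_scaleE. Qed.

Definition coker_pi : {linear V -> coker} := mk_linear coker_pi_linear.

Lemma coker_pi_onto (p : coker) : exists v, coker_pi v = p.
Proof. exact: coker_pi_surj. Qed.

Lemma coker_piP v : coker_pi v = 0 <-> exists u, f u = v.
Proof.
rewrite -[0](linear0 coker_pi); split=> [/coker_pi_eq|] [u].
  by rewrite subr0; exists u.
by move=> e; apply/coker_pi_eq; exists u; rewrite subr0.
Qed.

Section Lift.
Variables (Z : lmodType R) (g : {linear V -> Z}).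
Hypothesis gf0 : forall u, g (f u) = 0.

Definition coker_lift_fun (p : coker) : Z := g (projT1 (cid (coker_pi_surj p))).

Lemma coker_lift_funE v : coker_lift_fun (coker_pi v) = g v.
Proof.
rewrite /coker_lift_fun; case: cid => w /= /coker_pi_eq [u e].
by apply/eqP; rewrite -subr_eq0 -linearB -e gf0.
Qed.

Lemma coker_lift_linear : linear coker_lift_fun.
Proof.
move=> a p q; case: (coker_pi_surj p) (coker_pi_surj q) => v <- [w <-].
by rewrite -[coker_pi_fun]/(coker_pi : _ -> _) -linearP !coker_lift_funE linearP.
Qed.

Definition coker_lift : {linear coker -> Z} := mk_linear coker_lift_linear.

Lemma coker_liftE v : coker_lift (coker_pi v) = g v.
Proof. exact: coker_lift_funE. Qed.
End Lift.
End Cokernel.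

(** * Injective cogenerators of module categories *)

(** Division with remainder by the least positive member of [P]; the generator is 0 when there is
    none. *)
Lemma int_subgroup (P : int -> Prop) : P 0 -> (forall m n, P m -> P n -> P (m - n)) ->
  exists m : nat, forall n, P n <-> exists q : int, n = q * m%:Z.
Proof.
move=> P0 PB.
have PN n : P n -> P (- n) by move=> hn; rewrite -sub0r; apply: PB.
have PD m n : P m -> P n -> P (m + n) by move=> hm hn; rewrite -(opprK n); apply/PB/PN.
have PM m (n : int) : P m -> P (n * m).
  move=> hm; elim/int_ind: n => [|n hn|n hn]; first by rewrite mul0r.
    by rewrite -addn1 PoszD mulrDl mul1r; apply: PD.
  by rewrite -addn1 PoszD opprD mulrDl mulN1r; apply: PB.
(* Without positive members there are no negative ones either, since [P] is stable under
   opposites. *)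
have [[m0 h0]|hno] := pselect (exists m : nat, P m.+1); last first.
  exists 0 => n; split=> [|[q ->]]; last by rewrite mulr0.
  case: n => [[|n]|n] hn; first by exists 0.
    by case: hno; exists n.
  by case: hno; exists n; rewrite -[Posz _]opprK -NegzE; apply: PN.
have ex : exists m : nat, `[< P m.+1 >] by exists m0; apply/asboolP.
case: (ex_minnP ex) => m /asboolP hm mmin.
exists m.+1 => n; split=> [hn|[q ->]]; last exact: PM.
(* The remainder lies in [P] and is smaller than [m.+1], so minimality forces it to vanish. *)
exists (n %/ m.+1)%Z; have En := divz_eq n m.+1.
have hr : P (n %% m.+1)%Z.
  rewrite (_ : (n %% m.+1)%Z = n - (n %/ m.+1)%Z * m.+1); first by apply: PB => //; apply: PM.
  by rewrite {2}En addrAC subrr add0r.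
move: hr (modz_ge0 n (isT : m.+1 != 0 :> int)) (ltz_pmod n (isT : 0 < m.+1 :> int)) En.
case: (n %% m.+1)%Z => [[|r]|//] hr _ r_lt; first by rewrite addr0.
by have := mmin r (introT (asboolP _) hr); rewrite leqNgt -ltnS -[X in ~~ X]ltz_nat r_lt.
Qed.

(** * Extension of homomorphisms into a divisible group *)

Section Divisible.
Variable D : zmodType.
Hypothesis divD : forall (n : nat) (d : D), exists e, e *+ n.+1 = d.

Section Extension.
Variable Y : zmodType.
Local Open Scope classical_set_scope.

(* S is the graph of a homomorphism defined on a subgroup of Y (or is empty). *)
Definition partial_hom (S : set (Y * D)) : Prop :=
  (forall p q, S p -> S q -> S (p - q)) /\ (forall d, S (0, d) -> d = 0).

Lemma pair_mulrz (y : Y) (d : D) (n : int) : (y, d) *~ n = (y *~ n, d *~ n).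
Proof.
rewrite [LHS]surjective_pairing.
by rewrite -[((y, d) *~ n).1]/(fst _) -[((y, d) *~ n).2]/(snd _) !raddfMz.
Qed.

Lemma partial_hom0 S p : partial_hom S -> S p -> S 0.
Proof. by move=> [hB _] hp; rewrite -(subrr p); apply: hB. Qed.

Lemma partial_homN S p : partial_hom S -> S p -> S (- p).
Proof. by move=> hS hp; rewrite -(sub0r p); apply: hS.1 => //; exact: partial_hom0 hp. Qed.

Lemma partial_homD S p q : partial_hom S -> S p -> S q -> S (p + q).
Proof. by move=> hS hp hq; rewrite -(opprK q); apply: hS.1 => //; exact: partial_homN. Qed.

Lemma partial_homMz S p (n : int) : partial_hom S -> S p -> S (p *~ n).
Proof.
move=> hS hp; elim/int_ind: n => [|n hn|n hn]; first by apply: partial_hom0 hp.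
  by rewrite -addn1 PoszD mulrzDr; apply: partial_homD.
by rewrite -addn1 PoszD opprD mulrzDr; apply: hS.1.
Qed.

Lemma partial_hom_val (S : set (Y * D)) y (d e : D) :
  partial_hom S -> S (y, d) -> S (y, e) -> d = e.
Proof.
move=> hS hd he; apply/eqP; rewrite -subr_eq0; apply/eqP; apply: hS.2.
by rewrite -(subrr y); exact: (hS.1 _ _ hd he).
Qed.

(* y can be sent to any d with m d = S (m y), where the multiples of y in the domain of
   S are those of m y. *)
Lemma partial_hom_slope (S : set (Y * D)) (y : Y) : partial_hom S -> S 0 ->
  exists d, forall (n : int) e, S (y *~ n, e) -> e = d *~ n.
Proof.
move=> hS S0.
have [||m hm] := @int_subgroup (fun n => exists e, S (y *~ n, e)).
- by exists 0.
- move=> n n' [e he] [e' he']; exists (e - e').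
  by rewrite mulrzBr; exact: (hS.1 _ _ he he').
have [e he] : exists e, S (y *~ m, e) by apply/hm; exists 1; rewrite mul1r.
have [d hd] : exists d, d *~ m = e.
  case: m he {hm} => [|m] he; last exact: divD.
  by exists 0; rewrite mul0rz; apply/esym/hS.2; rewrite -(mulr0z y).
exists d => n e' hn; have [q En] : exists q : int, n = q * m%:Z by apply/hm; exists e'.
apply: (partial_hom_val hS hn).
by rewrite En mulrC !mulrzA hd -pair_mulrz; apply: partial_homMz.
Qed.

Lemma partial_hom_extend (S : set (Y * D)) : partial_hom S -> S 0 ->
  exists g : {additive Y -> D}, forall y d, S (y, d) -> g y = d.
Proof.
move=> hS S0.
pose P (T : set (Y * D)) := partial_hom T /\ (T = set0 \/ S `<=` T).
have [F FP Ftot|A [[hA [A0|SA]] Amax]] := @Zorn_bigcup _ P.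
- split.
    split=> [p q [X FX Xp] [Z FZ Zq]|d [X FX Xd]]; last by have [[_ h0] _] := FP _ FX; exact: h0.
    have [XZ|ZX] := Ftot _ _ FX FZ.
      by exists Z => //; have [[hB _] _] := FP _ FZ; apply: hB => //; exact: XZ.
    by exists X => //; have [[hB _] _] := FP _ FX; apply: hB => //; exact: ZX.
  have [[X [FX SX]]|hno] := pselect (exists X, F X /\ S `<=` X).
    by right=> p /SX Xp; exists X.
  left; rewrite -subset0 => p [X FX Xp].
  have [_ [X0|SX]] := FP _ FX; first by rewrite X0 in Xp.
  by case: hno; exists X.
- case: (Amax S); last by split=> //; right.
  by rewrite A0; split=> [//|]; move=> /(_ _ S0).
have hdom y : exists d, A (y, d).
  (* If [y] were outside the domain of [A], adjoining [(y, d)] with [d] an admissible slope would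
     give a strictly larger partial homomorphism [T]. *)
  apply: contrapT => hy; have [d hd] := partial_hom_slope y hA (SA _ S0).
  pose T := [set p : Y * D | exists a (n : int), A a /\ p = a + (y, d) *~ n].
  have AT : A `<=` T by move=> a Aa; exists a, 0; rewrite mulr0z addr0.
  case: (Amax T).
    split=> // /(_ (y, d)) h; apply: hy; exists d; apply: h.
    by exists 0, 1; split; [exact: SA|rewrite add0r].
  split; last by right=> p /SA /AT.
  split=> [_ _ [a [n [Aa ->]]] [b [m [Ab ->]]]|e [[a b] [n [Aa [ea eb]]]]].
    exists (a - b), (n - m); split; first exact: hA.1.
    by rewrite mulrzBr opprD addrACA.
  (* An element of [T] above 0 has [a] equal to -n y, and the choice of the slope [d] then forces
     [b] to be -n d, so its value is 0. *)
  have Ea : a = y *~ (- n).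
    move: ea; rewrite pair_mulrz /= => /esym/eqP.
    by rewrite addr_eq0 => /eqP ->; rewrite mulrNz.
  rewrite Ea in Aa; have := hd _ _ Aa.
  by rewrite eb pair_mulrz /= mulrNz => ->; rewrite addNr.
pose g y := projT1 (cid (hdom y)).
have hg y : A (y, g y) by exact: (projT2 (cid (hdom y))).
have gB : zmod_morphism g.
  move=> x y; apply: (partial_hom_val hA (hg _)).
  exact: (hA.1 _ _ (hg x) (hg y)).
pose G : {additive Y -> D} := HB.pack g (GRing.isZmodMorphism.Build Y D g gB).
exists G => y d /SA h /=.
exact: (partial_hom_val hA (hg y) h).
Qed.
End Extension.
End Divisible.

(** * The group Q/Z *)

Lemma rat_of_int_linear : linear (fun n : int^o => n%:~R : zmodule rat).
Proof. by move=> a x y; rewrite intrD intrM mulrzl. Qed.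

Definition ratz : lmodType int := coker (mk_linear rat_of_int_linear).
Definition ratz_pi : {linear zmodule rat -> ratz} := coker_pi (mk_linear rat_of_int_linear).

Lemma ratz_div (n : nat) (d : ratz) : exists e, e *+ n.+1 = d.
Proof.
have [v <-] := coker_pi_surj d.
exists (ratz_pi ((v : rat) / n.+1%:R : rat)); rewrite -raddfMn; congr coker_pi_fun.
by rewrite -[LHS]mulr_natr mulfVK // pnatr_eq0.
Qed.

Lemma ratz_torsion (m : nat) : m != 1 -> exists2 d : ratz, d != 0 & d *+ m = 0.
Proof.
(* The class of 1/m has order m. For m = 0 every element is killed, and 1/2 serves as a nonzero
   one. *)
move=> m1; pose m' := if m == 0 then 2 else m.
have m'gt1 : (1 < m')%N by rewrite /m'; case: m m1 {m'} => [|[|m]].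
exists (ratz_pi (m'%:R^-1 : rat)).
  apply/eqP => /coker_piP [n] /= /(congr1 (fun x : rat => x * m'%:R)).
  rewrite mulVf ?pnatr_eq0 -?lt0n ?(ltnW m'gt1) // => /eqP.
  rewrite -[m'%:R]/(m'%:~R) -intrM -[1]/(1%:~R) eqr_int => /eqP.
  move=> /(congr1 absz); rewrite abszM /= => /eqP; rewrite muln_eq1.
  by move=> /andP[_ /eqP e]; rewrite e in m'gt1.
have [->|m0] := eqVneq m 0%N; first by rewrite mulr0n.
rewrite -raddfMn; apply/coker_piP; exists 1.
by rewrite /m' (negbTE m0) -[RHS]mulr_natr mulVf // pnatr_eq0.
Qed.

(** The annihilator of [z] in the integers is generated by some m other than 1, so Q/Z has a nonzero
    element killed by m to which [z] can be sent; divisibility extends this from the cyclic subgroup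
    of [z] to all of [Y]. *)
Lemma ratz_separates (Y : zmodType) (z : Y) : z != 0 ->
  exists g : {additive Y -> ratz}, g z != 0.
Proof.
move=> z0; have [||m hm] := @int_subgroup (fun n => z *~ n = 0).
- exact: mulr0z.
- by move=> n n' hn hn'; rewrite mulrzBr hn hn' subrr.
have m1 : m != 1%N.
  apply: contraNneq z0 => m1; apply/eqP; rewrite -[LHS]mulr1z; apply/hm.
  by exists 1; rewrite m1.
have [d d0 dm] := ratz_torsion m1.
pose S := [set p | exists n : int, p = (z, d) *~ n]%classic.
have [||g hg] := @partial_hom_extend _ ratz_div Y S.
- split=> [_ _ [n ->] [n' ->]|e [n]]; first by exists (n - n'); rewrite mulrzBr.
  rewrite pair_mulrz => -[/esym/hm [q ->] ->].
  by rewrite mulrC mulrzA [d *~ m]dm mul0rz.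
- by exists 0; rewrite mulr0z.
by exists g; rewrite (hg z d) //; exists 1.
Qed.

Lemma ratz_extends (X Y : zmodType) (i : {additive X -> Y}) (f : {additive X -> ratz}) :
  injective i -> exists g : {additive Y -> ratz}, forall x, g (i x) = f x.
Proof.
move=> i_inj; pose S := [set p | exists x, p = (i x, f x)]%classic.
have [||g hg] := @partial_hom_extend _ ratz_div Y S.
- split=> [_ _ [x ->] [y ->]|e [x [/esym]]].
    by exists (x - y); rewrite !raddfB.
  by rewrite -(raddf0 i) => /i_inj ->; rewrite raddf0.
- by exists 0; rewrite !raddf0.
by exists g => x; apply: hg; exists x.
Qed.


(** * The coinduced module Hom_Z(R, Q/Z) *)

Section Cofree.
Variable R : pzRingType.

Definition additive_fct : {pred R -> ratz} :=
  [pred u | `[< forall x y, u (x + y) = u x + u y >]].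

Lemma additive_fct_zmod : zmod_closed additive_fct.
Proof.
split=> [|u v /asboolP hu /asboolP hv]; apply/asboolP => x y /=.
  by rewrite addr0.
by rewrite -[LHS]/(u (x + y) - v (x + y)) hu hv opprD addrACA.
Qed.

HB.instance Definition _ := GRing.isZmodClosed.Build _ additive_fct additive_fct_zmod.

Record cofree := Cofree { cofree_val :> R -> ratz; _ : cofree_val \in additive_fct }.

HB.instance Definition _ := [isSub for cofree_val].
HB.instance Definition _ := [Choice of cofree by <:].
HB.instance Definition _ := [SubChoice_isSubZmodule of cofree by <:].

Lemma cofreeD (u : cofree) x y : u (x + y) = u x + u y.
Proof. by case: u => u /= /asboolP. Qed.

Lemma cofree_ext (u v : cofree) : u =1 v -> u = v.
Proof. by move=> e; apply: val_inj; apply: funext. Qed.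

Definition mk_cofree (u : R -> ratz) (hu : forall x y, u (x + y) = u x + u y) : cofree :=
  Cofree (introT (asboolP _) hu : u \in additive_fct).

Lemma cofree_scale_subproof (a : R) (u : cofree) x y :
  u ((x + y) * a) = u (x * a) + u (y * a).
Proof. by rewrite mulrDl cofreeD. Qed.

(** Right translation of the argument is what makes Hom_Z(R, Q/Z) a left [R]-module. *)
Definition cofree_scale (a : R) (u : cofree) : cofree :=
  mk_cofree (cofree_scale_subproof a u).

Lemma cofree_scaleA a b u : cofree_scale a (cofree_scale b u) = cofree_scale (a * b) u.
Proof. by apply: cofree_ext => x /=; rewrite mulrA. Qed.
Lemma cofree_scale1 : left_id 1 cofree_scale.
Proof. by move=> u; apply: cofree_ext => x /=; rewrite mulr1. Qed.
Lemma cofree_scaleDr : right_distributive cofree_scale +%R.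
Proof. by move=> a u v; apply: cofree_ext => x. Qed.
Lemma cofree_scaleDl u : {morph cofree_scale^~ u : a b / a + b}.
Proof. by move=> a b; apply: cofree_ext => x /=; rewrite mulrDr cofreeD. Qed.

HB.instance Definition _ := GRing.Zmodule_isLmodule.Build R cofree
  cofree_scaleA cofree_scale1 cofree_scaleDr cofree_scaleDl.

Lemma cofreeZ (a : R) (u : cofree) x : (a *: u) x = u (x * a).
Proof. by []. Qed.

Section Coextension.
Variables (X : lmodType R) (g : {additive X -> ratz}).

Lemma cofree_lift_subproof x (r s : R) : g ((r + s) *: x) = g (r *: x) + g (s *: x).
Proof. by rewrite scalerDl raddfD. Qed.

Lemma cofree_lift_linear : linear (fun x => mk_cofree (cofree_lift_subproof x)).
Proof.
move=> a x y; apply: cofree_ext => r /=.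
by rewrite scalerDr raddfD scalerA.
Qed.

(** The adjunct of [g] under Hom_Z(X, Q/Z) = Hom_R(X, Hom_Z(R, Q/Z)); evaluation at 1 goes back. *)
Definition cofree_lift : {linear X -> cofree} := mk_linear cofree_lift_linear.

Lemma cofree_liftE x r : cofree_lift x r = g (r *: x).
Proof. by []. Qed.
End Coextension.

Lemma cofree_eval_additive (X : lmodType R) (f : {linear X -> cofree}) :
  zmod_morphism (fun x => f x 1).
Proof. by move=> x y; rewrite linearB. Qed.

(** By the adjunction, the problem becomes the extension of the additive map x |-> f x 1 into
    Q/Z. *)
Lemma cofree_extends (X Y : lmodType R) (i : {linear X -> Y}) (f : {linear X -> cofree}) :
  injective i -> exists g : {linear Y -> cofree}, forall x, g (i x) = f x.
Proof.
move=> i_inj.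
pose f1 : {additive X -> ratz} :=
  HB.pack (fun x => f x 1) (GRing.isZmodMorphism.Build X ratz _ (cofree_eval_additive f)).
have [g hg] := @ratz_extends X Y i f1 i_inj.
exists (cofree_lift g) => x; apply: cofree_ext => r.
by rewrite cofree_liftE -linearZ hg /= linearZ cofreeZ mul1r.
Qed.

Lemma cofree_separates (X : lmodType R) (x : X) : x != 0 ->
  exists g : {linear X -> cofree}, g x != 0.
Proof.
move=> /ratz_separates [g gx]; exists (cofree_lift g).
apply: contraNneq gx => /(congr1 (fun u : cofree => u 1)).
by rewrite cofree_liftE scale1r => ->.
Qed.
End Cofree.

Section ModuleCategory.
Variables (k : comPzRingType) (B : kalgebra k).

(** The inclusion of the kernel and the zero map agree after composition with [f], hence are
    equal. *)
Lemma mod_mono_inj (X Y : lmodType B^c) (f : {linear X -> Y}) :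
  @is_mono (mod_cat B) X Y f -> injective f.
Proof.
move=> mf x y e; apply/eqP; rewrite -subr_eq0; apply/eqP.
have hz : f (x - y) == 0 by rewrite linearB e subrr.
have e0 : ker_inc f = zero_map (kerm f) X.
  apply: (mf (kerm f)); apply: linear_ext => u /=.
  by rewrite linear0; exact: (ker_incP u).
exact: (congr1 (fun u : {linear kerm f -> X} => u (Kerm hz)) e0).
Qed.

Definition mod_inj_cogen : lmodType B^c := cofree B^c.

Lemma mod_inj_cogen_inj : @is_injective (mod_cat B) mod_inj_cogen.
Proof.
move=> X Y i /mod_mono_inj /cofree_extends ext f.
by have [g hg] := ext f; exists g; apply: linear_ext.
Qed.

(** If every [g] killed [x], the map b |-> b x from the regular module would be indistinguishable
    from zero by maps into [Q], hence zero; evaluating it at 1 gives x = 0. *)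
Lemma mod_cogen_separates (Q X : lmodType B^c) (x : X) :
  @is_cogenerator (mod_cat B) Q -> x <> 0 -> exists g : {linear X -> Q}, g x <> 0.
Proof.
move=> cQ hx; apply: contrapT => hno; apply: hx.
have fl : linear (fun b : (B^c)^o => b *: x) by move=> a b c; rewrite scalerDl scalerA.
have e : mk_linear fl = zero_map (B^c)^o X.
  apply: (cQ (B^c)^o X) => g; apply: linear_ext => b /=.
  rewrite linearZ linear0 /=; have [->|hg] := pselect (g x = 0); first by rewrite scaler0.
  by case: hno; exists g.
by have /= := congr1 (fun u : {linear (B^c)^o -> X} => u 1) e; rewrite scale1r.
Qed.

Lemma mod_inj_cogen_cogen : @is_cogenerator (mod_cat B) mod_inj_cogen.
Proof.
move=> X Y f g e; apply: linear_ext => x; apply/eqP; rewrite -subr_eq0.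
apply/negPn/negP => /cofree_separates [u]; case/negP; rewrite linearB subr_eq0.
by apply/eqP; exact: (congr1 (fun v : {linear (X : lmodType B^c) -> mod_inj_cogen} => v x) (e u)).
Qed.
End ModuleCategory.

(** * Kernels and cokernels of comodules *)

Section ComoduleCategory.
Variables (k : comPzRingType) (A : kalgebra k) (C : coring A).

Lemma comod_zero_colin (X Y : comodule C) x :
  com_rho Y (zero_map X Y x) = tmap (zero_map X Y) (idb C) (com_rho X x).
Proof. by rewrite linear0 tmap_zero. Qed.

Definition comod_zero (X Y : comodule C) : comod_hom X Y :=
  ComodHom (@comod_zero_colin X Y).

Lemma comod_inj_mono (X Y : comodule C) (f : comod_hom X Y) :
  injective f -> @is_mono (comod_cat C) X Y f.
Proof.
move=> f_inj W u v e; apply: comod_hom_ext => x; apply: f_inj.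
exact: (congr1 (fun w : comod_hom W Y => w x) e).
Qed.

Lemma comod_bij_iso (X Y : comodule C) (f : comod_hom X Y) :
  injective f -> (forall y, exists x, f x = y) -> @is_iso (comod_cat C) X Y f.
Proof.
move=> f_inj f_surj; pose g y := projT1 (cid (f_surj y)).
have fg y : f (g y) = y by exact: (projT2 (cid (f_surj y))).
have gl : linear g by move=> a x y; apply: f_inj; rewrite linearP !fg.
have gc y : com_rho X (mk_linear gl y) = tmap (mk_linear gl) (idb C) (com_rho Y y).
  rewrite -{2}(fg y) com_funP tmap_ll -[LHS]tmap_id.
  by apply: tmap_eq => // x /=; apply: f_inj; rewrite fg.
exists (ComodHom gc); split; apply: comod_hom_ext => x //=.
by apply: f_inj; rewrite fg.
Qed.

Section Kernel.
Hypothesis flatC : flat_left C.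
Variables (X Y : comodule C) (f : comod_hom X Y).

(** By flatness the kernel of f (x) C is the image of ker f (x) C, and colinearity of [f] puts the
    coaction of a kernel element in that kernel. *)
Lemma ker_comod_sub (x : kerm f) :
  exists z, tmap (ker_inc f) (idb C) z = com_rho X (ker_inc f x).
Proof.
by apply/(flatC (ker_exact f)); rewrite -com_funP [com_fun f _]ker_incP linear0.
Qed.

Definition ker_comod : comodule C :=
  @sub_comodule k A C flatC X _ (ker_inc f) (@ker_inc_inj _ _ _ f) ker_comod_sub.

Definition ker_comod_inc : comod_hom ker_comod X :=
  @sub_inc k A C flatC X _ (ker_inc f) (@ker_inc_inj _ _ _ f) ker_comod_sub.
End Kernel.

Section Cokernel.
Variables (K X : comodule C) (i : comod_hom K X).

Let W : lmodType A^c := coker i.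
Let pi : {linear X -> W} := coker_pi i.

Lemma coker_pi_i x : pi (i x) = 0.
Proof. by apply/coker_piP; exists x. Qed.

(** The composite of the coaction of [X] with pi (x) C kills the image of [i], because [i] is
    colinear and pi kills [i]; so it descends to the cokernel. *)
Definition coker_rho : {linear W -> tensr W C} :=
  @coker_lift _ _ _ i (tensr W C) (compl (tmap pi (idb C)) (com_rho X))
    (fun x => etrans (congr1 (tmap pi (idb C)) (com_funP i x))
       (etrans (tmap_ll pi i (com_rho K x)) (tmap_zero (f := compl pi i) _ coker_pi_i))).

Lemma coker_rhoE x : coker_rho (pi x) = tmap pi (idb C) (com_rho X x).
Proof. exact: coker_liftE. Qed.

Lemma coker_coassoc w :
  tassoc (tmap coker_rho (idb C) (coker_rho w)) = tmap (idl W) (cor_delta C) (coker_rho w).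
Proof.
have [x <-] := coker_pi_onto w; rewrite coker_rhoE.
rewrite tmap_rl -(tmap_lr pi (cor_delta C)) -com_coassoc -tassoc_natl !tmap_ll.
by apply: (congr1 tassoc); apply: tmap_eq => // y; exact: coker_rhoE.
Qed.

Lemma coker_counit w : tunitr W (tmap (idl W) (cor_eps C) (coker_rho w)) = w.
Proof.
have [x <-] := coker_pi_onto w; rewrite coker_rhoE.
by rewrite tmap_rl -(tmap_lr pi) tunitr_nat com_counit.
Qed.

Definition coker_comod : comodule C := Comodule coker_coassoc coker_counit.

Definition coker_comod_pi : comod_hom X coker_comod :=
  @ComodHom k A C X coker_comod pi coker_rhoE.

Section Lift.
Variables (Z : comodule C) (g : comod_hom X Z) (gi0 : forall x, g (i x) = 0).

Lemma coker_comod_lift_colin (w : coker_comod) :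
  com_rho Z (coker_lift gi0 w) = tmap (coker_lift gi0) (idb C) (com_rho coker_comod w).
Proof.
have [x <-] := coker_pi_onto w; rewrite coker_rhoE.
rewrite coker_liftE com_funP tmap_ll; apply: tmap_eq => // y.
exact: (esym (coker_liftE gi0 y)).
Qed.

Definition coker_comod_lift : comod_hom coker_comod Z :=
  @ComodHom k A C coker_comod Z (coker_lift gi0) coker_comod_lift_colin.

Lemma coker_comod_liftE x : coker_comod_lift (coker_comod_pi x) = g x.
Proof. exact: coker_liftE. Qed.
End Lift.
End Cokernel.
End ComoduleCategory.

(** * The isomorphism between h(W (x) L) and W (x) e(L) *)

Section Cohom.
Variables (k : comPzRingType) (B A : kalgebra k) (C : coring A).
Variables (L : bcomodule B C) (h : functor (comod_cat C) (mod_cat B)).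
Variable adj : adjunction h (tensor_functor L).

Let EB : bimodule B B := coend_bim adj.
Let E : coring B := coend adj.
Let theta (M : comodule C) := cohom_unit adj M.
Let thetab : bimod_hom L (tensb EB L) := cohom_unitb adj.

Definition cohom (M : comodule C) : lmodType B^c := h M.
Definition cohom_fmap (M M' : comodule C) (f : comod_hom M M') :
  {linear cohom M -> cohom M'} := fmap h f.

Lemma cohom_ext (M : comodule C) (W : lmodType B^c) (f g : {linear cohom M -> W}) :
  (forall x, tmap f (idb L) (theta M x) = tmap g (idb L) (theta M x)) -> f = g.
Proof. exact: cohom_uniq. Qed.

Lemma cohom_fmapE (M M' : comodule C) (f : comod_hom M M') x :
  tmap (cohom_fmap f) (idb L) (theta M x) = theta M' (f x).
Proof. exact: cohom_unit_nat. Qed.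

Lemma cohom_fmap1 (M : comodule C) y : cohom_fmap (comod_id M) y = y.
Proof. exact: (congr1 (fun u : {linear cohom M -> cohom M} => u y) (fmap1 h M)). Qed.

Lemma cohom_fmapM (M M' M'' : comodule C) (f : comod_hom M' M'') (g : comod_hom M M') y :
  cohom_fmap (comod_comp f g) y = cohom_fmap f (cohom_fmap g y).
Proof.
exact: (congr1 (fun u : {linear cohom M -> cohom M''} => u y) (fmapM h f g)).
Qed.

Lemma cohom_fmap0 (M M' : comodule C) (f : comod_hom M M') y :
  (forall x, f x = 0) -> cohom_fmap f y = 0.
Proof.
move=> f0; suff -> : cohom_fmap f = zero_map (cohom M) (cohom M') by [].
by apply: cohom_ext => x; rewrite cohom_fmapE f0 linear0 tmap_zero.
Qed.

Section FreeComodule.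
Variable W : lmodType B^c.

Lemma tpurel_colin (w : W) (x : bco_comod L) :
  com_rho (tenf_obj L W) (tpurel L w x) = tmap (tpurel L w) (idb C) (com_rho (bco_comod L) x).
Proof. by rewrite [LHS]tenf_rhoE tmapE tassoc'l. Qed.

Definition tpurec (w : W) : comod_hom (bco_comod L) (tenf_obj L W) :=
  @ComodHom k A C (bco_comod L) (tenf_obj L W) (tpurel L w) (tpurel_colin w).

Lemma tenf_theta_colin (y : tenf_obj L W) :
  com_rho (tenf_obj L (tensr W EB)) (compl tassoc' (tmap (idl W) thetab) y) =
  tmap (compl tassoc' (tmap (idl W) thetab)) (idb C) (com_rho (tenf_obj L W) y).
Proof. by rewrite -(tmap_ll tassoc'); exact: (tensor_unit_colin adj). Qed.

(** The map W (x) theta_L, rebracketed. For a comodule [N] in place of [W], it forms with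
    [tenf_map L (com_rho N)] the parallel pair whose equalizer is the cotensor product. *)
Definition tenf_theta : comod_hom (tenf_obj L W) (tenf_obj L (tensr W EB)) :=
  @ComodHom k A C (tenf_obj L W) (tenf_obj L (tensr W EB))
    (compl tassoc' (tmap (idl W) thetab)) tenf_theta_colin.

Definition cohom_tens : {linear cohom (tenf_obj L W) -> tensr W EB} :=
  cohom_tr adj tenf_theta.

Lemma cohom_tensE y :
  tmap cohom_tens (idb L) (theta (tenf_obj L W) y) = tassoc' (tmap (idl W) thetab y).
Proof. exact: cohom_trE. Qed.

Lemma cohom_tens_pure w e : cohom_tens (cohom_fmap (tpurec w) e) = tpure w (e : EB).
Proof.
suff eq : compl cohom_tens (cohom_fmap (tpurec w)) = tpurel EB w.
  exact: (congr1 (fun u : {linear EB -> tensr W EB} => u e) eq).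
apply: cohom_ext => x; rewrite -(tmap_ll cohom_tens) cohom_fmapE cohom_tensE.
by rewrite tmapE tassoc'l.
Qed.

Lemma cohom_tens_inv_balanced :
  @lbalanced k B B W EB (cohom (tenf_obj L W)) (fun w e => cohom_fmap (tpurec w) e).
Proof.
split=> [w w' e|w e e'|w b e|w e b]; last 1 first.
- exact: linearZZ.
- have lin : linear (fun e => cohom_fmap (tpurec w) e + cohom_fmap (tpurec w') e).
    by move=> a u v; rewrite !linearP scalerDr addrACA.
  suff -> : cohom_fmap (tpurec (w + w')) = mk_linear lin by [].
  apply: cohom_ext => x; rewrite cohom_fmapE.
  rewrite (@tmap_add _ _ _ _ _ _ (cohom_fmap (tpurec w)) (cohom_fmap (tpurec w'))) //.
  rewrite !cohom_fmapE -linearD; apply: (congr1 (theta _)); exact: tpureDl.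
- exact: linearD.
(* The left action on e(L) is [h] applied to the left action on [L], so balancing over [B] is
   functoriality combined with the balancing of W (x) L. *)
- rewrite -[lact b e]/(cohom_fmap (bco_lact L b) e) -cohom_fmapM.
  apply: (congr1 (fun u => cohom_fmap u e)); apply: comod_hom_ext => x.
  exact: tpure_bal.
Qed.

Definition cohom_tens_inv : {linear tensr W EB -> cohom (tenf_obj L W)} :=
  tensr_lift cohom_tens_inv_balanced.

Lemma cohom_tens_invE w e : cohom_tens_inv (tpure w e) = cohom_fmap (tpurec w) e.
Proof. exact: tensr_liftE. Qed.

(** Transposes are unique, so it suffices to compare after theta, and there on pure tensors;
    naturality of theta along [tpurec w] settles that case. *)
Lemma cohom_tensK : cancel cohom_tens cohom_tens_inv.
Proof.
move=> z; suff e : compl cohom_tens_inv cohom_tens = idl (cohom (tenf_obj L W)).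
  exact: (congr1 (fun u : {linear cohom (tenf_obj L W) -> _} => u z) e).
apply: cohom_ext => y; rewrite -(tmap_ll cohom_tens_inv) cohom_tensE tmap_id.
elim/tensr_ind: y => [w x|p q hp hq]; last by rewrite !linearD hp hq.
rewrite tmapE tassoc'l tmap_ll -[RHS](cohom_fmapE (tpurec w)).
by apply: tmap_eq => // e; exact: cohom_tens_invE.
Qed.

Lemma cohom_tens_invK : cancel cohom_tens_inv cohom_tens.
Proof.
elim/tensr_ind => [w e|p q hp hq]; last by rewrite !linearD hp hq.
by rewrite cohom_tens_invE cohom_tens_pure.
Qed.
End FreeComodule.

Lemma cohom_tens_nat (W W' : lmodType B^c) (g : {linear W -> W'}) y :
  cohom_tens W' (cohom_fmap (tenf_map L g) y) = tmap g (idb EB) (cohom_tens W y).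
Proof.
suff e : compl (cohom_tens W') (cohom_fmap (tenf_map L g)) =
         compl (tmap g (idb EB)) (cohom_tens W).
  exact: (congr1 (fun u : {linear cohom (tenf_obj L W) -> _} => u y) e).
apply: cohom_ext => x; rewrite -(tmap_ll (cohom_tens W')).
rewrite -(tmap_ll (tmap g _)) cohom_fmapE !cohom_tensE.
by rewrite -tassoc'_natl tmap_lr tmap_rl.
Qed.

Lemma tenf_theta_nat (W W' : lmodType B^c) (g : {linear W -> W'}) y :
  tenf_theta W' (tmap g (idb L) y) = tmap (tmap g (idb EB)) (idb L) (tenf_theta W y).
Proof.
rewrite -[LHS]/(tassoc' (tmap (idl W') thetab (tmap g (idb L) y))).
by rewrite -tassoc'_natl tmap_lr tmap_rl.
Qed.

(** Coassociativity of the left coaction theta_L, tensored with [W] and rebracketed by the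
    pentagon. *)
Lemma tenf_theta_coassoc (W : lmodType B^c) y :
  tmap (compl tassoc' (tmap (idl W) (cor_delta E))) (idb L) (tenf_theta W y) =
  tenf_theta (tensr W EB) (tenf_theta W y).
Proof.
rewrite -[tenf_theta _ (tenf_theta _ _)]/(tassoc' (tmap (idl _) thetab (tenf_theta W y))).
rewrite -[tenf_theta W y]/(tassoc' (tmap (idl W) thetab y)) -(tmap_ll tassoc').
rewrite -tassoc'_natm tassoc'_pentagon2 tmap_rr.
rewrite -tassoc'_natr !tmap_rr; apply: (congr1 tassoc'); apply: (congr1 tassoc').
apply: tmap_eq => // l; exact: (coend_bic_coassoc adj l).
Qed.

(** With [cohom_tens_nat], this identifies the image under [h] of the pair defining the cotensor
    product with the pair rho_N (x) e(L), N (x) Delta_e. *)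
Lemma cohom_tens_delta (W : lmodType B^c) y :
  cohom_tens (tensr W EB) (cohom_fmap (tenf_theta W) y) =
  tassoc' (tmap (idl W) (cor_delta E) (cohom_tens W y)).
Proof.
suff e : compl (cohom_tens (tensr W EB)) (cohom_fmap (tenf_theta W)) =
         compl (compl tassoc' (tmap (idl W) (cor_delta E))) (cohom_tens W).
  exact: (congr1 (fun u : {linear cohom (tenf_obj L W) -> _} => u y) e).
apply: cohom_ext => x; rewrite -(tmap_ll (cohom_tens _)) cohom_fmapE cohom_tensE.
rewrite -(tmap_ll (compl tassoc' (tmap (idl W) (cor_delta E)))) cohom_tensE.
exact: (esym (tenf_theta_coassoc x)).
Qed.
End Cohom.

(** * Comparison with comodules over e(L) *)

(** Componentwise inverses are again natural. This reverses the unit, which points from the identity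
    to the composite, whereas [inverse_equivalences] asks for the other direction. *)
Lemma natural_iso_sym (X Y : category) (F G : functor X Y) (t : forall x, Defs.hom (F x) (G x)) :
  (forall x y (f : Defs.hom x y), Defs.comp (t y) (fmap F f) = Defs.comp (fmap G f) (t x)) ->
  (forall x, is_iso (t x)) -> naturally_isomorphic G F.
Proof.
move=> nat iso; pose s x := projT1 (cid (iso x)).
have [st ts] : (forall x, Defs.comp (s x) (t x) = idc (F x)) /\
               (forall x, Defs.comp (t x) (s x) = idc (G x)).
  by split=> x; have [] := projT2 (cid (iso x)).
have snat x y (f : Defs.hom x y) : Defs.comp (s y) (fmap G f) = Defs.comp (fmap F f) (s x).
  rewrite -[LHS]compc1 -(ts x) -compcA (compcA (fmap G f)) -nat -compcA compcA.
  by rewrite st comp1c.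
exists (Nattrans snat) => x; exists (t x); split; [exact: ts|exact: st].
Qed.

Section Comparison.
Variables (k : comPzRingType) (B A : kalgebra k) (C : coring A).
Variables (L : bcomodule B C) (h : functor (comod_cat C) (mod_cat B)).
Variable adj : adjunction h (tensor_functor L).
Hypothesis flatC : flat_left C.

Let EB : bimodule B B := coend_bim adj.
Let E : coring B := coend adj.
Let theta (M : comodule C) := cohom_unit adj M.
Let thetab : bimod_hom L (tensb EB L) := cohom_unitb adj.
Let LE : bicomodule E C := coend_bicomodule adj.

Section Counit.
Variable N : comodule E.

Definition cot_comod_inc : comod_hom (cotensor_comod flatC LE N) (tenf_obj L N) :=
  @ComodHom k A C (cotensor_comod flatC LE N) (tenf_obj L N) (cot_inc LE N)
    (fun p => esym (@cot_rhoE _ _ _ _ _ flatC LE N p)).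

Lemma cot_comod_inc_inj : injective cot_comod_inc.
Proof. exact: cot_inc_inj. Qed.

Lemma cot_comod_incP p :
  tenf_map L (com_rho N) (cot_comod_inc p) = tenf_theta adj N (cot_comod_inc p).
Proof. by rewrite -[LHS]tassocK; apply: (congr1 tassoc'); exact: (@cot_incP _ _ _ _ _ LE N p). Qed.

Section Lift.
Variables (X : comodule C) (g : comod_hom X (tenf_obj L N)).
Hypothesis hg : forall x, tenf_map L (com_rho N) (g x) = tenf_theta adj N (g x).

Lemma cot_lift_ex x : exists p, cot_inc LE N p = g x.
Proof. by apply: cot_incE; rewrite -[RHS]tassoc'K; apply: (congr1 tassoc) (hg x). Qed.

Definition cot_lift_fun x := projT1 (cid (cot_lift_ex x)).

Lemma cot_lift_funE x : cot_inc LE N (cot_lift_fun x) = g x.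
Proof. exact: (projT2 (cid (cot_lift_ex x))). Qed.

Lemma cot_lift_linear : linear cot_lift_fun.
Proof.
move=> a x y; apply: (@cot_inc_inj _ _ _ _ _ LE N).
by rewrite linearP !cot_lift_funE linearP.
Qed.

Lemma cot_lift_colin (x : X) :
  com_rho (cotensor_comod flatC LE N) (mk_linear cot_lift_linear x) =
  tmap (mk_linear cot_lift_linear) (idb C) (com_rho X x).
Proof.
apply: (flat_inj flatC (@cot_inc_inj _ _ _ _ _ LE N)).
rewrite cot_rhoE tmap_ll [cot_inc _ _ _]cot_lift_funE [LHS]com_funP.
by apply: tmap_eq => // y; exact: (esym (cot_lift_funE y)).
Qed.

Definition cot_lift : comod_hom X (cotensor_comod flatC LE N) :=
  @ComodHom k A C X (cotensor_comod flatC LE N) (mk_linear cot_lift_linear) cot_lift_colin.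

Lemma cot_liftE x : cot_comod_inc (cot_lift x) = g x.
Proof. exact: cot_lift_funE. Qed.
End Lift.

(** The counit of the comparison, obtained by transposing the inclusion of the cotensor product in N
    (x) L. *)
Definition cot_counit_lin : {linear cohom h (cotensor_comod flatC LE N) -> N} :=
  cohom_tr adj cot_comod_inc.

Lemma cot_counit_linE p :
  tmap cot_counit_lin (idb L) (theta _ p) = cot_comod_inc p.
Proof. exact: cohom_trE. Qed.

Lemma cot_counit_colin z :
  com_rho N (cot_counit_lin z) =
  tmap cot_counit_lin (idb E) (com_rho (cohom_comod adj (cotensor_comod flatC LE N)) z).
Proof.
suff e : compl (com_rho N) cot_counit_lin =
         compl (tmap cot_counit_lin (idb E)) (cohom_rho adj (cotensor_comod flatC LE N)).
  exact: (congr1 (fun u : {linear cohom h (cotensor_comod flatC LE N) -> _} => u z) e).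
apply: (cohom_ext (adj := adj)) => p; rewrite -(tmap_ll (com_rho N)).
rewrite -(tmap_ll (tmap cot_counit_lin _)) cohom_rhoE cot_counit_linE.
rewrite -tassoc'_natl tmap_lr -(tmap_rl cot_counit_lin) cot_counit_linE.
exact: cot_comod_incP.
Qed.

Definition cot_counit :
    comod_hom (cohom_comod adj (cotensor_comod flatC LE N)) N :=
  @ComodHom k B E (cohom_comod adj (cotensor_comod flatC LE N)) N
    cot_counit_lin cot_counit_colin.

(** Both sides transpose to the two composites that the inclusion of the cotensor product equalizes.
    Thus [h] of the inclusion is, up to isomorphism, the counit followed by the coaction of [N]. *)
Lemma cohom_tens_inc z :
  cohom_tens adj N (cohom_fmap h cot_comod_inc z) = com_rho N (cot_counit z).
Proof.
suff e : compl (cohom_tens adj N) (cohom_fmap h cot_comod_inc) =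
         compl (com_rho N) cot_counit_lin.
  exact: (congr1 (fun u : {linear cohom h (cotensor_comod flatC LE N) -> _} => u z) e).
apply: (cohom_ext (adj := adj)) => p; rewrite -(tmap_ll (cohom_tens adj N)).
rewrite -(tmap_ll (com_rho N)) cohom_fmapE cohom_tensE cot_counit_linE.
exact: (esym (cot_comod_incP p)).
Qed.

(** The equalizer condition read on elements; that the image of the inclusion lies in the equalizer
    is functoriality of [h]. *)
Definition cohom_preserves_equalizer : Prop :=
  injective (cohom_fmap h cot_comod_inc) /\
  forall z, cohom_fmap h (tenf_map L (com_rho N)) z = cohom_fmap h (tenf_theta adj N) z ->
    exists p, cohom_fmap h cot_comod_inc p = z.

Lemma com_rho_inj : injective (com_rho N).
Proof. by move=> x y e; rewrite -(com_counit x) e com_counit. Qed.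

(** Injectivity passes through the isomorphism [cohom_tens]. For surjectivity, coassociativity says
    that the coaction of [y], moved into h(N (x) L), is equalized, hence comes from some [p]; the
    coaction being injective, [p] is sent to [y]. *)
Lemma cot_counit_bij : cohom_preserves_equalizer ->
  injective cot_counit /\ forall y, exists z, cot_counit z = y.
Proof.
move=> [inj ex]; split=> [z z' e|y].
  by apply: inj; apply: (can_inj (cohom_tensK adj (W := N))); rewrite !cohom_tens_inc e.
have [|p hp] := ex (cohom_tens_inv adj N (com_rho N y)).
  apply: (can_inj (cohom_tensK adj (W := tensr N EB))).
  rewrite cohom_tens_nat cohom_tens_delta cohom_tens_invK.
  by rewrite -[LHS]tassocK; apply: (congr1 tassoc'); exact: com_coassoc.
by exists p; apply: com_rho_inj; rewrite -cohom_tens_inc hp cohom_tens_invK.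
Qed.
End Counit.

Lemma cot_counit_nat (N N' : comodule E) (f : comod_hom N N') z :
  cot_counit N' (cohom_map adj (cot_map flatC LE f) z) = f (cot_counit N z).
Proof.
suff e : compl (cot_counit_lin N') (cohom_fmap h (cot_map flatC LE f)) =
         compl f (cot_counit_lin N).
  exact: (congr1 (fun u : {linear cohom h (cotensor_comod flatC LE N) -> _} => u z) e).
apply: (cohom_ext (adj := adj)) => p; rewrite -(tmap_ll (cot_counit_lin N')).
rewrite -(tmap_ll f) cohom_fmapE !cot_counit_linE.
exact: (@cot_map_funE _ _ _ _ _ LE N N' f p).
Qed.

Section Unit.
Variable M : comodule C.

(** The map theta_M corestricted to the cotensor product; the equalizing condition is the defining
    equation of the coaction on h(M). *)
Definition cot_unit :
    comod_hom M (cotensor_comod flatC LE (cohom_comod adj M)) :=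
  @cot_lift (cohom_comod adj M) M (theta M) (cohom_rhoE adj (M := M)).

Lemma cot_unitE x : cot_comod_inc (cohom_comod adj M) (cot_unit x) = theta M x.
Proof. exact: cot_liftE. Qed.

Lemma cot_unit_counit z :
  cot_counit (cohom_comod adj M) (cohom_fmap h cot_unit z) = z.
Proof.
suff e : compl (cot_counit_lin (cohom_comod adj M)) (cohom_fmap h cot_unit) =
         idl (cohom h M).
  exact: (congr1 (fun u : {linear cohom h M -> cohom h M} => u z) e).
apply: (cohom_ext (adj := adj)) => x; rewrite -(tmap_ll (cot_counit_lin _)).
by rewrite cohom_fmapE cot_counit_linE cot_unitE tmap_id.
Qed.
End Unit.

Lemma cot_unit_nat (M M' : comodule C) (f : comod_hom M M') x :
  cot_unit M' (f x) = cot_map flatC LE (cohom_map adj f) (cot_unit M x).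
Proof.
apply: (@cot_inc_inj _ _ _ _ _ LE (cohom_comod adj M')).
rewrite [RHS](@cot_map_funE _ _ _ _ _ LE _ _ (cohom_map adj f)) [LHS]cot_unitE.
rewrite -[cot_inc _ _ _]/(cot_comod_inc _ (cot_unit M x)) cot_unitE.
exact: (esym (cohom_fmapE adj f x)).
Qed.

Definition cohom_faithful : Prop :=
  forall (M M' : comodule C) (f g : comod_hom M M'),
    cohom_fmap h f = cohom_fmap h g -> f = g.

Lemma cohom_faithful0 (M M' : comodule C) (f : comod_hom M M') : cohom_faithful ->
  (forall z, cohom_fmap h f z = 0) -> forall x, f x = 0.
Proof.
move=> faith f0 x; suff -> : f = comod_zero M M' by [].
by apply: faith; apply: linear_ext => z; rewrite f0 (cohom_fmap0 adj).
Qed.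

Lemma cot_unit_bij (M : comodule C) : cohom_faithful ->
  injective (cot_counit (cohom_comod adj M)) ->
  injective (cot_unit M) /\ forall p, exists x, cot_unit M x = p.
Proof.
move=> faith inj; split.
  (* The counit retracts [h] of the unit, so [h] kills the kernel inclusion; faithfulness makes that
     inclusion zero. *)
  have ker0 : forall x, ker_comod_inc flatC (cot_unit M) x = 0.
    apply: cohom_faithful0 => // z; rewrite -[LHS]cot_unit_counit -cohom_fmapM.
    rewrite (cohom_fmap0 adj) ?linear0 // => x; exact: (ker_incP x).
  move=> x y e; apply/eqP; rewrite -subr_eq0.
  have hk : cot_unit M (x - y) == 0 by rewrite linearB e subrr.
  by apply/eqP; exact: (ker0 (Kerm hk)).
(* Dually, the counit is injective, so [h] of the unit is onto and [h] kills the cokernel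
   projection. *)
move=> p; apply/coker_piP.
suff: forall q, coker_comod_pi (cot_unit M) q = 0 by exact.
apply: cohom_faithful0 => // z.
have <- : cohom_fmap h (cot_unit M) (cot_counit (cohom_comod adj M) z) = z.
  by apply: inj; exact: cot_unit_counit.
by rewrite -cohom_fmapM (cohom_fmap0 adj) // => x; exact: coker_pi_i.
Qed.

Lemma comparison_equivalence : cohom_faithful ->
  (forall N, cohom_preserves_equalizer N) ->
  inverse_equivalences (cotensor_functor flatC LE) (cohom_functor adj).
Proof.
move=> faith pres; split.
  pose t (N : comod_cat E) : Defs.hom
    (functor_comp (cohom_functor adj) (cotensor_functor flatC LE) N)
    (functor_id (comod_cat E) N) := cot_counit N.
  have nat N N' (f : @Defs.hom (comod_cat E) N N') :
      Defs.comp (t N') (fmap _ f) = Defs.comp (fmap (functor_id _) f) (t N).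
    by apply: comod_hom_ext => z; exact: cot_counit_nat.
  exists (Nattrans nat) => N; apply: comod_bij_iso.
    exact: (cot_counit_bij (pres N)).1.
  exact: (cot_counit_bij (pres N)).2.
pose t (M : comod_cat C) : Defs.hom (functor_id (comod_cat C) M)
  (functor_comp (cotensor_functor flatC LE) (cohom_functor adj) M) := cot_unit M.
apply: (@natural_iso_sym _ _ _ _ t) => [M M' f|M].
  by apply: comod_hom_ext => x; exact: cot_unit_nat.
have [inj surj] := cot_unit_bij faith (cot_counit_bij (pres (cohom_comod adj M))).1.
exact: comod_bij_iso.
Qed.
End Comparison.

(** * Preservation of the equalizers *)

Section Difference.
Variables (k : comPzRingType) (A : kalgebra k).

Lemma map_sub_linear (R : pzRingType) (U V : lmodType R) (f g : {linear U -> V}) :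
  linear (fun x => f x - g x).
Proof. by move=> a x y; rewrite (linearP f) (linearP g) scalerBr opprD addrACA. Qed.

Definition map_sub (R : pzRingType) (U V : lmodType R) (f g : {linear U -> V}) :
  {linear U -> V} := mk_linear (map_sub_linear f g).

Lemma tmap_sub (B : kalgebra k) (M M' : lmodType B^c) (N : bimodule B A)
    (f g : {linear M -> M'}) (p : tensr M N) :
  tmap (map_sub f g) (idb N) p = tmap f (idb N) p - tmap g (idb N) p.
Proof.
apply/eqP; rewrite eq_sym subr_eq; apply/eqP.
by apply: tmap_add => x; rewrite /= subrK.
Qed.

Variables (C : coring A) (X Y : comodule C) (f g : comod_hom X Y).

Lemma comod_sub_colin x :
  com_rho Y (map_sub f g x) = tmap (map_sub f g) (idb C) (com_rho X x).
Proof. by rewrite tmap_sub linearB !com_funP. Qed.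

(** Differences turn the equalizer of a parallel pair into a kernel, to which exactness applies. *)
Definition comod_sub : comod_hom X Y := ComodHom comod_sub_colin.
End Difference.

Section Exactness.
Variables (k : comPzRingType) (B A : kalgebra k) (C : coring A).
Variables (L : bcomodule B C) (h : functor (comod_cat C) (mod_cat B)).
Variable adj : adjunction h (tensor_functor L).

Lemma cohom_fmapB (X Y : comodule C) (f g : comod_hom X Y) z :
  cohom_fmap h (comod_sub f g) z = cohom_fmap h f z - cohom_fmap h g z.
Proof.
suff -> : cohom_fmap h (comod_sub f g) = map_sub (cohom_fmap h f) (cohom_fmap h g) by [].
apply: (cohom_ext (adj := adj)) => x; rewrite tmap_sub !cohom_fmapE.
exact: (linearB (cohom_unit adj Y)).
Qed.

Definition cohom_untr (M : comodule C) (W : lmodType B^c) (u : {linear cohom h M -> W}) :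
  comod_hom M (tenf_obj L W) := comod_comp (tenf_map L u) (cohom_unit adj M).

Lemma cohom_untrK (M : comodule C) (W : lmodType B^c) (g : comod_hom M (tenf_obj L W)) :
  cohom_untr (cohom_tr adj g) = g.
Proof. by apply: comod_hom_ext => x; exact: cohom_trE. Qed.

Lemma cohom_untr_comp (M M' : comodule C) (W : lmodType B^c) (f : comod_hom M M')
    (u : {linear cohom h M' -> W}) x :
  cohom_untr u (f x) = cohom_untr (compl u (cohom_fmap h f)) x.
Proof.
rewrite -[RHS]/(tmap (compl u _) (idb L) (cohom_unit adj M x)).
by rewrite -(tmap_ll u) cohom_fmapE.
Qed.

Variable Q : lmodType B^c.

(** Every map v from M' to Q (x) L is the transpose of some u, and v f is the transpose of u h(f),
    so it depends on h(f) alone. *)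
Lemma cogenerator_faithful :
  @is_cogenerator (comod_cat C) (tenf_obj L Q) -> cohom_faithful h.
Proof.
move=> cogen M M' f g e; apply: (cogen M M') => v; apply: comod_hom_ext => x.
rewrite -[v]cohom_untrK -[LHS]/(cohom_untr _ (f x)) -[RHS]/(cohom_untr _ (g x)).
by rewrite !cohom_untr_comp e.
Qed.

Hypothesis injQL : @is_injective (comod_cat C) (tenf_obj L Q).
Hypothesis cogenQ : @is_cogenerator (mod_cat B) Q.

Lemma comod_extend (X Y : comodule C) (i : comod_hom X Y) (u : comod_hom X (tenf_obj L Q)) :
  injective i -> exists v : comod_hom Y (tenf_obj L Q), forall x, v (i x) = u x.
Proof.
move=> /comod_inj_mono /injQL /(_ u) [v e]; exists v => x.
exact: (congr1 (fun w : comod_hom X (tenf_obj L Q) => w x) e).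
Qed.

(** A linear [u] into [Q] that separates two points identified by h(i) would transpose to a map K ->
    Q (x) L; extending this along [i] factors [u] through h(i), a contradiction. *)
Lemma cohom_inj (K X : comodule C) (i : comod_hom K X) :
  injective i -> injective (cohom_fmap h i).
Proof.
move=> i_inj z w e; apply/eqP; rewrite -subr_eq0; apply/eqP; apply: contrapT.
move=> /(mod_cogen_separates cogenQ) [u]; apply.
have [v hv] := comod_extend (cohom_untr u) i_inj.
have -> : u = compl (cohom_tr adj v) (cohom_fmap h i).
  apply: (cohom_ext (adj := adj)) => x; rewrite -[RHS]/(cohom_untr _ x) -cohom_untr_comp.
  by rewrite cohom_untrK hv.
by rewrite /= !linearB /= e subrr.
Qed.

(** Otherwise some [u] from the cokernel of h(i) to [Q] is nonzero on the class of [z]. Its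
    transpose kills the image of [i], hence lives on the cokernel of [i], which embeds in [Y] by
    exactness. Extending to [Y] shows that [u] after the projection factors through h(f), which
    kills [z]. *)
Lemma cohom_exact (K X Y : comodule C) (i : comod_hom K X) (f : comod_hom X Y) z :
  exact_at i f -> cohom_fmap h f z = 0 -> exists w, cohom_fmap h i w = z.
Proof.
move=> ex fz; apply/coker_piP; apply: contrapT.
move=> /(mod_cogen_separates cogenQ) [u]; apply.
have fi0 x : f (i x) = 0 by apply/ex; exists x.
have ui0 x : cohom_untr (compl u (coker_pi (cohom_fmap h i))) (i x) = 0.
  rewrite cohom_untr_comp; apply: tmap_zero => y /=.
  by rewrite [coker_pi_fun _ _](_ : _ = 0) ?linear0 //; apply/coker_piP; exists y.
have j_inj : injective (coker_comod_lift fi0).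
  move=> p q e; apply/eqP; rewrite -subr_eq0; move: e => /eqP.
  rewrite -subr_eq0 -linearB; have [x <-] := coker_pi_onto (p - q).
  rewrite [_ (coker_pi _ _)]coker_comod_liftE => /eqP /ex ?; apply/eqP; exact/coker_piP.
have [v hv] := comod_extend (coker_comod_lift ui0) j_inj.
suff e : compl u (coker_pi (cohom_fmap h i)) = compl (cohom_tr adj v) (cohom_fmap h f).
  rewrite -[LHS]/(compl u (coker_pi (cohom_fmap h i)) z) e.
  by rewrite -[LHS]/(cohom_tr adj v (cohom_fmap h f z)) fz linear0.
apply: (cohom_ext (adj := adj)) => x.
rewrite -[LHS]/(cohom_untr _ x) -[RHS]/(cohom_untr _ x) -cohom_untr_comp.
by rewrite cohom_untrK -(coker_comod_liftE fi0) hv coker_comod_liftE.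
Qed.

Lemma injective_preserves (flatC : flat_left C) (N : comodule (coend adj)) :
  cohom_preserves_equalizer flatC N.
Proof.
split=> [|z e]; first exact/cohom_inj/cot_comod_inc_inj.
apply: (@cohom_exact _ _ _ _ (comod_sub (tenf_map L (com_rho N)) (tenf_theta adj N))).
  move=> y; split=> [/eqP|[p <-]]; rewrite /= ?subr_eq0.
    move=> /eqP e'; apply: (@cot_incE _ _ _ _ _ (coend_bicomodule adj)).
    by rewrite -[RHS]tassoc'K; apply: (congr1 tassoc) e'.
  by apply/eqP; rewrite subr_eq0; apply/eqP; exact: cot_comod_incP.
by rewrite cohom_fmapB e subrr.
Qed.
End Exactness.

(** * Coseparability and split equalizers *)

Section Coseparable.
Variables (k : comPzRingType) (B : kalgebra k) (E : coring B) (p : bimod_hom (tensb E E) E).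
Hypothesis p_delta : forall x, p (cor_delta E x) = x.
Hypothesis p_left : forall z : tensb E E,
  cor_delta E (p z) = tmap (idl E) p (tassoc (tmap (cor_delta E) (idb E) z)).
Hypothesis p_right : forall z : tensb E E,
  cor_delta E (p z) = tmap p (idb E) (tassoc' (tmap (idl E) (cor_delta E) z)).
Variable N : comodule E.

(* n (x) e |-> n_0 (x) p(n_1 (x) e) *)
Let q : {linear tensr N E -> tensr N E} :=
  compl (tmap (idl N) p) (compl tassoc (tmap (com_rho N) (idb E))).

(** The map n (x) e |-> n_0 eps(p(n_1 (x) e)), a colinear retraction of the coaction of [N]. *)
Definition cosep_retract : {linear tensr N E -> N} :=
  compl (tunitr N) (compl (tmap (idl N) (cor_eps E)) q).

Lemma cosep_retractK x : cosep_retract (com_rho N x) = x.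
Proof.
rewrite /cosep_retract /= com_coassoc !tmap_rr.
rewrite -[RHS]com_counit; apply: (congr1 (tunitr N)); apply: tmap_eq => // e /=.
by rewrite p_delta.
Qed.

(** Left colinearity of [p] puts the values of [q] in the equalizer of rho_N (x) E and N (x) Delta,
    that is, in the image of rho_N; the counit then recovers the preimage, which is
    [cosep_retract]. *)
Let q_rho y :
  tmap (com_rho N) (idb E) (q y) = tassoc' (tmap (idl N) (cor_delta E) (q y)).
Proof.
rewrite -[LHS]tassocK; apply: (congr1 tassoc').
rewrite -[q y]/(tmap (idl N) p (tassoc (tmap (com_rho N) (idb E) y))).
rewrite tmap_lr -(tmap_rl (com_rho N) p) -tassoc_natl tassoc_natr tmap_rr.
have e z : tmap (idl N) (compb (cor_delta E) p) z =
    tmap (idl N) (tmapb (idb E) p) (tmap (idl N) (tassocb E E E)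
      (tmap (idl N) (tmapb (cor_delta E) (idb E)) z)).
  by rewrite !tmap_rr; apply: tmap_eq => // w; exact: p_left.
rewrite e -tassoc_natm tmap_ll; apply: (congr1 (tmap _ _)).
rewrite -tassoc_pentagon !tmap_ll; apply: (congr1 (tmap _ _)); apply: (congr1 tassoc).
by apply: tmap_eq => // x; exact: com_coassoc.
Qed.

Lemma cosep_retract_rho y : com_rho N (cosep_retract y) = q y.
Proof.
rewrite -[cosep_retract y]/(tunitr N (tmap (idl N) (cor_eps E) (q y))).
rewrite -tunitr_nat tmap_lr -(tmap_rl (com_rho N)) q_rho -tassoc'_natr tunitr_assoc.
move: (q y) => z; rewrite !tmap_rr -[RHS]tmap_id.
by apply: tmap_eq => // x; exact: cor_counitr.
Qed.

(** Here N (x) E carries the coaction N (x) Delta. Right colinearity of [p] turns the right-hand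
    side into n_0 (x) eps(x_1) x_2 with x = p(n_1 (x) e), which the left counit law reduces to
    [q y]. *)
Lemma cosep_retract_colin y :
  com_rho N (cosep_retract y) =
  tmap cosep_retract (idb E) (tassoc' (tmap (idl N) (cor_delta E) y)).
Proof.
rewrite cosep_retract_rho /cosep_retract /q -!(tmap_ll (tunitr N)).
rewrite -!(tmap_ll (tmap (idl N) (cor_eps E))) -(tmap_ll (tmap (idl N) p)).
rewrite -(tmap_ll tassoc) -tassoc'_natl tmap_lr -(tmap_rl (com_rho N)).
set y1 := tmap (com_rho N) (idb E) y.
rewrite -[y1 in RHS]tassocK -tassoc'_natr -tassoc'_pentagon -!tassoc'_natm tunit_triangle.
rewrite !tmap_rr; apply: tmap_eq => // w /=.
by rewrite -p_right cor_counitl.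
Qed.
End Coseparable.

Section SplitEqualizer.
Variables (k : comPzRingType) (B A : kalgebra k) (C : coring A).
Variables (L : bcomodule B C) (h : functor (comod_cat C) (mod_cat B)).
Variables (adj : adjunction h (tensor_functor L)) (flatC : flat_left C).

(** With s = pi (x) L, one has s (rho_N (x) L) = 1, and s (N (x) theta_L) factors as the inclusion
    after some [r] that retracts it. These equations are preserved by any functor. *)
Lemma coseparable_preserves (N : comodule (coend adj)) :
  coseparable (coend adj) -> cohom_preserves_equalizer flatC N.
Proof.
move=> [p [p_delta p_left p_right]].
pose pi := cosep_retract p N; pose s := tenf_map L pi.
have s_rho y : s (tenf_map L (com_rho N) y) = y.
  rewrite -[LHS]/(tmap pi (idb L) (tmap (com_rho N) (idb L) y)) tmap_ll -[RHS]tmap_id.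
  by apply: tmap_eq => // x; exact: cosep_retractK.
(* Naturality moves pi past theta, coassociativity replaces the iterated theta by Delta, and
   colinearity of pi concludes. *)
have hg x : tenf_map L (com_rho N) (comod_comp s (tenf_theta adj N) x) =
            tenf_theta adj N (comod_comp s (tenf_theta adj N) x).
  rewrite -[RHS]/(tenf_theta adj N (tmap pi (idb L) (tenf_theta adj N x))).
  rewrite tenf_theta_nat -tenf_theta_coassoc !tmap_ll.
  by apply: tmap_eq => // y; exact: cosep_retract_colin.
pose r := cot_lift flatC hg.
have r_inc y : cot_comod_inc flatC N (r y) = s (tenf_theta adj N y) by exact: cot_liftE.
split.
  apply: (@can_inj _ _ _ (cohom_fmap h r)) => z; rewrite -cohom_fmapM -[RHS]cohom_fmap1.
  apply: (congr1 (fun f => cohom_fmap h f z)); apply: comod_hom_ext => y.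
  apply: (cot_comod_inc_inj (flatC := flatC)); rewrite [LHS]r_inc.
  by rewrite -cot_comod_incP s_rho.
move=> z e; exists (cohom_fmap h r z).
have -> : cohom_fmap h (cot_comod_inc flatC N) (cohom_fmap h r z) =
          cohom_fmap h s (cohom_fmap h (tenf_theta adj N) z).
  rewrite -!cohom_fmapM; apply: (congr1 (fun f => cohom_fmap h f z)).
  by apply: comod_hom_ext => y; exact: r_inc.
(* As [z] is equalized, h(N (x) theta_L) may be replaced by h(rho_N (x) L), which h(s) retracts. *)
rewrite -e -cohom_fmapM -[RHS]cohom_fmap1.
by apply: (congr1 (fun f => cohom_fmap h f z)); apply: comod_hom_ext => y; exact: s_rho.
Qed.
End SplitEqualizer.

Theorem proposition3p2p6
  (k : comPzRingType) (A B : kalgebra k) (C : coring A)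
  (flatC : flat_left C)
  (L : bcomodule B C)
  (h : functor (comod_cat C) (mod_cat B))
  (adj : adjunction h (tensor_functor L))
  (flatE : flat_left (coend adj)) :
  (flat_right C -> flat_right (coend adj) -> injector_cogenerator L ->
   inverse_equivalences
     (cotensor_functor flatC (coend_bicomodule adj)) (cohom_functor adj)) /\
  (coseparable C -> coseparable (coend adj) -> cogenerator_preserving L ->
   inverse_equivalences
     (cotensor_functor flatC (coend_bicomodule adj)) (cohom_functor adj)).
Proof.
(* Both assumptions on [L] are applied to the coinduced module, an injective cogenerator of right
   [B]-modules. *)
have injQ := @mod_inj_cogen_inj k B; have cogenQ := @mod_inj_cogen_cogen k B.
split=> [_ _ injL|_ cosepE cogenL]; apply: comparison_equivalence => [|N].
- exact/(cogenerator_faithful adj)/(injL _ (conj injQ cogenQ)).2.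
- exact: injective_preserves (injL _ (conj injQ cogenQ)).1 cogenQ _ _.
- exact/(cogenerator_faithful adj)/(cogenL _ cogenQ).
- exact: coseparable_preserves.
Qed.
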